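(* For $\eta\in\mathbb{D}(E^{\sigma})$, the Poisson kernel $K(\eta)$ and the characteristic operator $\Theta_{\eta}$ are related by the equation $$I=K(\eta)K(\eta)^{*}+\Theta_{\eta}\Theta_{\eta}^{*}$$ on $\mathcal{F}(E)\otimes_{\sigma}\mathcal{D}_{*}$.
   Context: $M$ is a $W^*$-algebra and $E$ is a $W^*$-correspondence over $M$: a self-dual (right) Hilbert $C^*$-module over $M$ together with a normal $*$-homomorphism $\varphi:M\to\mathcal{L}(E)$ giving the left action. $E^{\otimes n}$ denotes the balanced tensor powers (as $W^*$-correspondences, $E^{\otimes 0}=M$), and the Fock space is $\mathcal{F}(E)=\bigoplus_{n\ge0}E^{\otimes n}$. $\sigma:M\to B(H)$ is a normal representation on a Hilbert space $H$ (nondegenerate, so that $M\otimes_\sigma H$ is identified with $H$). Write $I_k=I_{E^{\otimes k}}$. $E^\sigma$ is the space of bounded operators $\eta:H\to E\otimes_\sigma H$ with $\eta\sigma(a)=(\varphi(a)\otimes I_H)\eta$ for all $a\in M$; $\mathbb{D}(E^\sigma)$ is its open unit ball. Fix $\eta\in\mathbb{D}(E^\sigma)$. Set $\eta^{(0)}=I_H$, $\eta^{(n)}=(I_{n-1}\otimes\eta)\cdots(I_1\otimes\eta)\eta:H\to E^{\otimes n}\otimes_\sigma H$. The defect operators are $\Delta_*=(I_H-\eta^*\eta)^{1/2}\in\sigma(M)'$ and $\Delta=(I_{E\otimes H}-\eta\eta^* )^{1/2}\in(\varphi(M)\otimes I_H)'$, with ranges $\mathcal{D}_*$ and $\mathcal{D}$;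 since $\|\eta\|<1$, $\mathcal{D}_*=H$ and $\mathcal{D}=E\otimes_\sigma H$. The Poisson kernel $K(\eta):H\to\mathcal{F}(E)\otimes_\sigma H=\mathcal{F}(E)\otimes_\sigma\mathcal{D}_*$ is $K(\eta)h=\big((I_k\otimes\Delta_* )\eta^{(k)}h\big)_{k\ge0}$. Define the bounded operator $\theta_\eta:\mathcal{D}\to\mathcal{F}(E)\otimes_\sigma\mathcal{D}_*$ by $$\theta_\eta d=-\eta^*d+(I_1\otimes\Delta_* )\Delta d+\sum_{k=2}^\infty(I_k\otimes\Delta_* )(I_1\otimes\eta^{(k-1)})\Delta d,\qquad d\in\mathcal{D},$$ where the terms lie respectively in the summands $\mathcal{D}_*$, $E\otimes\mathcal{D}_*$, and $E^{\otimes k}\otimes\mathcal{D}_*$. The characteristic operator is the bounded operator $\Theta_\eta:\mathcal{F}(E)\otimes_{\varphi\otimes I|\mathcal{D}}\mathcal{D}\to\mathcal{F}(E)\otimes_\sigma\mathcal{D}_*$ determined by $\Theta_\eta(\xi\otimes d)=\xi\otimes\theta_\eta d$ for $\xi\in\mathcal{F}(E)$, $d\in\mathcal{D}$, where $\mathcal{D}$ carries the representation $a\mapsto(\varphi(a)\otimes I_H)|_{\mathcal{D}}$ of $M$ and $E^{\otimes j}\otimes(E^{\otimes i}\otimes\mathcal{D}_* )$ is identified with $E^{\otimes(i+j)}\otimes\mathcal{D}_*$. *)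

(* Defs.v *)
(* Scalars are R[i] for R : realType; every inner product is linear in its
   second variable. *)
From HB Require Import structures.
From mathcomp Require Import all_boot all_order all_algebra.
From mathcomp Require Import all_classical all_reals all_analysis.
From mathcomp Require Import complex.

Set Implicit Arguments.
Unset Strict Implicit.
Unset Printing Implicit Defensive.
Import Order.TTheory GRing.Theory Num.Theory numFieldNormedType.Exports.
Local Open Scope classical_set_scope.
Local Open Scope complex_scope.
Local Open Scope ring_scope.

(* The unital algebra structure is spelled out: the library hierarchy does not
   allow joining its normed modules with its rings.  The zero algebra is
   allowed. *)
HB.mixin Record isCStarAlgebra (R : realType) A
    of CompleteNormedModule R[i] A := {
  amul : A -> A -> A;
  aone : A;
  amulA : associative amul;
  amul1l : left_id aone amul;
  amul1r : right_id aone amul;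
  amul_linearl : forall (c : R[i]) (a b d : A),
    amul (c *: a + b) d = c *: amul a d + amul b d;
  amul_linearr : forall (c : R[i]) (a b d : A),
    amul a (c *: b + d) = c *: amul a b + amul a d;
  star : A -> A;
  starD : forall a b : A, star (a + b) = star a + star b;
  starZ : forall (c : R[i]) (a : A), star (c *: a) = c^* *: star a;
  starM : forall a b : A, star (amul a b) = amul (star b) (star a);
  starK : involutive star;
  amul_norm : forall a b : A, `|amul a b| <= `|a| * `|b|;
  star_norm : forall a : A, `|amul (star a) a| = `|a| ^+ 2
}.

#[short(type="cstarAlgType")]
HB.structure Definition CStarAlgebra (R : realType) :=
  {A of CompleteNormedModule R[i] A & isCStarAlgebra R A}.

(* [pairing] identifies the algebra isometrically with the dual of [predual]. *)
HB.mixin Record isWStarAlgebra (R : realType) A of CStarAlgebra R A := {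
  predual : completeNormedModType R[i];
  pairing : A -> predual -> R[i];
  pairing_linearl : forall (c : R[i]) (a b : A) (p : predual),
    pairing (c *: a + b) p = c * pairing a p + pairing b p;
  pairing_linearr : forall (c : R[i]) (a : A) (p q : predual),
    pairing a (c *: p + q) = c * pairing a p + pairing a q;
  pairing_bound : forall (a : A) (p : predual), `|pairing a p| <= `|a| * `|p|;
  pairing_norm : forall (a : A) (c : R[i]), 0 <= c ->
    (forall p : predual, `|pairing a p| <= c * `|p|) -> `|a| <= c;
  pairing_onto : forall (f : predual -> R[i]) (c : R[i]),
    (forall (k : R[i]) (p q : predual), f (k *: p + q) = k * f p + f q) ->
    (forall p : predual, `|f p| <= c * `|p|) ->
    exists a : A, forall p, f p = pairing a p
}.

#[short(type="wstarAlgType")]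
HB.structure Definition WStarAlgebra (R : realType) :=
  {A of CStarAlgebra R A & isWStarAlgebra R A}.

HB.mixin Record isHilbert (R : realType) V of CompleteNormedModule R[i] V := {
  dot : V -> V -> R[i];
  dot_linear : forall (c : R[i]) (x y z : V),
    dot x (c *: y + z) = c * dot x y + dot x z;
  dot_conj : forall x y : V, dot y x = (dot x y)^*;
  dot_norm : forall x : V, dot x x = `|x| ^+ 2
}.

#[short(type="hilbertType")]
HB.structure Definition Hilbert (R : realType) :=
  {V of CompleteNormedModule R[i] V & isHilbert R V}.

Definition lspan (R : realType) (V : lmodType R[i]) (S : set V) : set V :=
  [set v | exists (n : nat) (c : 'I_n -> R[i]) (s : 'I_n -> V),
    (forall k, S (s k)) /\ v = \sum_k c k *: s k].

Definition bounded_op (R : realType) (U V : normedModType R[i]) (T : U -> V) :=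
  linear T /\ exists c : R[i], forall x, `|T x| <= c * `|x|.

Definition adj (R : realType) (U V : hilbertType R) (T : U -> V) : V -> U :=
  xget (fun=> 0) [set S : V -> U |
    bounded_op S /\ forall x y, dot (T x) y = dot x (S y)].

Definition psqrt (R : realType) (V : hilbertType R) (A : V -> V) : V -> V :=
  xget (fun=> 0) [set S : V -> V |
    [/\ bounded_op S, forall x, 0 <= dot x (S x) & forall x, S (S x) = A x]].

HB.mixin Record isHilbertModule (R : realType) (M : cstarAlgType R) E
    of CompleteNormedModule R[i] E := {
  ract : E -> M -> E;
  ractDl : forall (x y : E) (a : M), ract (x + y) a = ract x a + ract y a;
  ractDr : forall (x : E) (a b : M), ract x (a + b) = ract x a + ract x b;
  ractZl : forall (c : R[i]) (x : E) (a : M), ract (c *: x) a = c *: ract x a;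
  ractZr : forall (c : R[i]) (x : E) (a : M), ract x (c *: a) = c *: ract x a;
  ractM : forall (x : E) (a b : M), ract x (amul a b) = ract (ract x a) b;
  ract1 : forall x : E, ract x aone = x;
  inner : E -> E -> M;
  inner_linear : forall (c : R[i]) (x y z : E),
    inner x (c *: y + z) = c *: inner x y + inner x z;
  inner_ract : forall (x y : E) (a : M), inner x (ract y a) = amul (inner x y) a;
  inner_star : forall x y : E, inner y x = star (inner x y);
  inner_pos : forall x : E, exists b : M, inner x x = amul (star b) b;
  inner_norm : forall x : E, `|inner x x| = `|x| ^+ 2
}.

#[short(type="hilbertModType")]
HB.structure Definition HilbertModule (R : realType) (M : cstarAlgType R) :=
  {E of CompleteNormedModule R[i] E & isHilbertModule R M E}.

Section WeakStar.
Variables (R : realType) (M : wstarAlgType R) (E : hilbertModType M).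

Definition self_dual := forall (f : E -> M) (c : R[i]),
  (forall x y, f (x + y) = f x + f y) ->
  (forall x (a : M), f (ract x a) = amul (f x) a) ->
  (forall x, `|f x| <= c * `|x|) ->
  exists y : E, forall x, f x = inner y x.

(* Norm-closed span of the functionals v |-> w(<x, v>), x in E, w in the
   predual of M: for self-dual E this is the predual of E. *)
Definition wstar_cont (f : E -> R[i]) := forall eps : R[i], 0 < eps ->
  exists (n : nat) (p : 'I_n -> predual (s := M)) (x : 'I_n -> E),
  forall v, `|f v - \sum_k pairing (inner (x k) v) (p k)| <= eps * `|v|.

(* The linear span of S is dense in E for the weak-* topology. *)
Definition wstar_total (S : set E) :=
  forall (z : E) (n : nat) (f : 'I_n -> E -> R[i]) (eps : R[i]),
  (forall k, wstar_cont (f k)) -> 0 < eps ->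
  exists2 v, lspan S v & forall k, `|f k z - f k v| < eps.

Definition adjointable (T : E -> E) :=
  exists S : E -> E, forall x y, inner (T x) y = inner x (S y).

(* The predual of L(E): norm-closed span of the functionals
   T |-> w(<x, T y>); only the values at adjointable T are relevant. *)
Definition wstar_cont_adjointable (f : (E -> E) -> R[i]) :=
  forall eps : R[i], 0 < eps ->
  exists (n : nat) (p : 'I_n -> predual (s := M)) (x y : 'I_n -> E),
  forall (T : E -> E) (c : R[i]), adjointable T -> 0 <= c ->
  (forall v, `|T v| <= c * `|v|) ->
  `|f T - \sum_k pairing (inner (x k) (T (y k))) (p k)| <= eps * c.

End WeakStar.

(* The left action a |-> lact a is a normal unital *-homomorphism M -> L(E);
   by [lact_adj], lact a is adjointable, hence linear and bounded. *)
HB.mixin Record isWCorrespondence (R : realType) (M : wstarAlgType R) E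
    of HilbertModule R M E := {
  wcorr_self_dual : self_dual (M := M) E;
  lact : M -> E -> E;
  lact_linear : forall (c : R[i]) (a b : M) (x : E),
    lact (c *: a + b) x = c *: lact a x + lact b x;
  lactM : forall (a b : M) (x : E), lact (amul a b) x = lact a (lact b x);
  lact1 : forall x : E, lact aone x = x;
  lact_adj : forall (a : M) (x y : E),
    inner (lact a x) y = inner x (lact (star a) y) :> M;
  lact_normal : forall f : (E -> E) -> R[i],
    wstar_cont_adjointable (M := M) f ->
    exists p : predual (s := M), forall a : M, f (lact a) = pairing a p
}.

#[short(type="wcorrType")]
HB.structure Definition WCorrespondence (R : realType) (M : wstarAlgType R) :=
  {E of HilbertModule R M E & isWCorrespondence R M E}.

Definition ultraweak_cont (R : realType) (H : hilbertType R)
    (f : (H -> H) -> R[i]) := forall eps : R[i], 0 < eps ->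
  exists (n : nat) (x y : 'I_n -> H),
  forall (T : H -> H) (c : R[i]), linear T -> 0 <= c ->
  (forall v, `|T v| <= c * `|v|) ->
  `|f T - \sum_k dot (x k) (T (y k))| <= eps * c.

Record normal_rep (R : realType) (M : wstarAlgType R) (H : hilbertType R)
    (sigma : M -> H -> H) : Prop := NormalRep {
  rep_bounded : forall a, bounded_op (sigma a);
  rep_linear : forall (c : R[i]) (a b : M) (h : H),
    sigma (c *: a + b) h = c *: sigma a h + sigma b h;
  repM : forall (a b : M) (h : H), sigma (amul a b) h = sigma a (sigma b h);
  rep_star : forall (a : M) (h k : H),
    dot (sigma a h) k = dot h (sigma (star a) k);
  rep_nondegenerate :
    closure (lspan [set v | exists (a : M) (h : H), v = sigma a h]) = setT;
  rep_normal : forall f : (H -> H) -> R[i], ultraweak_cont f ->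
    exists p : predual (s := M), forall a : M, f (sigma a) = pairing a p
}.

(* Tensor products, tensor powers and the Fock space are specified up to
   unique isomorphism by their inner products and the density of the simple
   tensors; statements are meant to quantify over all models. *)

Record htensor (R : realType) (M : wstarAlgType R) (X : hilbertModType M)
    (H : hilbertType R) (rho : M -> H -> H) := HTensor {
  ht_space :> hilbertType R;
  ht : X -> H -> ht_space;
  ht_linearl : forall (c : R[i]) (x y : X) (h : H),
    ht (c *: x + y) h = c *: ht x h + ht y h;
  ht_linearr : forall (c : R[i]) (x : X) (h k : H),
    ht x (c *: h + k) = c *: ht x h + ht x k;
  ht_balanced : forall (x : X) (a : M) (h : H), ht (ract x a) h = ht x (rho a h);
  ht_dot : forall (x y : X) (h k : H),
    dot (ht x h) (ht y k) = dot h (rho (inner x y) k);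
  ht_total :
    closure (lspan [set v | exists (x : X) (h : H), v = ht x h]) = setT
}.

Record is_wtensor (R : realType) (M : wstarAlgType R) (X Y Z : wcorrType M)
    (t : X -> Y -> Z) : Prop := IsWTensor {
  wt_linearl : forall (c : R[i]) (x x' : X) (y : Y),
    t (c *: x + x') y = c *: t x y + t x' y;
  wt_linearr : forall (c : R[i]) (x : X) (y y' : Y),
    t x (c *: y + y') = c *: t x y + t x y';
  wt_balanced : forall (x : X) (a : M) (y : Y), t (ract x a) y = t x (lact a y);
  wt_ract : forall (x : X) (y : Y) (a : M), t x (ract y a) = ract (t x y) a;
  wt_lact : forall (a : M) (x : X) (y : Y), t (lact a x) y = lact a (t x y);
  wt_inner : forall (x x' : X) (y y' : Y),
    inner (t x y) (t x' y') = inner y (lact (inner x x') y') :> M;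
  wt_total :
    wstar_total (M := M) [set z : Z | exists (x : X) (y : Y), z = t x y]
}.

(* tp n is the n-th tensor power: tp 0 is M, viewed as a correspondence over
   itself through tp_unit, and tp n.+1 is the tensor product of tp n and E. *)
Record tensor_powers (R : realType) (M : wstarAlgType R) (E : wcorrType M) :=
    TensorPowers {
  tp : nat -> wcorrType M;
  tp_unit : M -> tp 0;
  tp_unit_linear : linear tp_unit;
  tp_unit_bij : bijective tp_unit;
  tp_unit_ract : forall a b : M, tp_unit (amul a b) = ract (tp_unit a) b;
  tp_unit_lact : forall a b : M, tp_unit (amul a b) = lact a (tp_unit b);
  tp_unit_inner : forall a b : M, inner (tp_unit a) (tp_unit b) = amul (star a) b;
  tpS : forall n, tp n -> E -> tp n.+1;
  tpS_tensor : forall n, is_wtensor (@tpS n)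
}.

(* The ultraweak direct sum of the tensor powers. *)
Record fock (R : realType) (M : wstarAlgType R) (E : wcorrType M)
    (P : tensor_powers E) := Fock {
  fock_corr :> wcorrType M;
  fock_in : forall n, tp P n -> fock_corr;
  fock_in_linear : forall n, linear (@fock_in n);
  fock_in_ract : forall n (x : tp P n) (a : M),
    fock_in (ract x a) = ract (fock_in x) a;
  fock_in_lact : forall n (a : M) (x : tp P n),
    fock_in (lact a x) = lact a (fock_in x);
  fock_in_inner : forall n (x y : tp P n),
    inner (fock_in x) (fock_in y) = inner x y :> M;
  fock_in_orth : forall m n (x : tp P m) (y : tp P n), m != n ->
    inner (fock_in x) (fock_in y) = 0 :> M;
  fock_total : wstar_total (M := M)
    [set z : fock_corr | exists n (x : tp P n), z = fock_in x]
}.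

Section Lifts.
Variables (R : realType) (M : wstarAlgType R).

(* The bounded operator sending x (x) h to g x h. *)
Definition ht_lift (X : hilbertModType M) (H : hilbertType R)
    (rho : M -> H -> H) (Y : htensor X rho) (Z : hilbertType R)
    (g : X -> H -> Z) : Y -> Z :=
  xget (fun=> 0) [set T : Y -> Z |
    bounded_op T /\ forall x h, T (ht Y x h) = g x h].

(* a |-> phi(a) (x) I *)
Definition ind_rep (X : wcorrType M) (H : hilbertType R) (rho : M -> H -> H)
    (Y : htensor X rho) (a : M) : Y -> Y :=
  ht_lift (fun x h => ht Y (lact a x) h).

Definition intertwiner (E : wcorrType M) (H : hilbertType R)
    (sigma : M -> H -> H) (EH : htensor E sigma) (eta : H -> EH) :=
  bounded_op eta /\ forall a h, eta (sigma a h) = ind_rep a (eta h).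

Definition in_open_ball (E : wcorrType M) (H : hilbertType R)
    (sigma : M -> H -> H) (EH : htensor E sigma) (eta : H -> EH) :=
  intertwiner eta /\
  exists2 c : R[i], c < 1 & forall h, `|eta h| <= c * `|h|.

End Lifts.

(* EH is E (x) H, TH n is E^n (x) H, FH is F(E) (x) H and FD is F(E) (x) EH.
   When |eta| < 1 the defect operators are invertible, so that the defect
   spaces (their ranges) are H and EH. *)

Section Poisson.
Variables (R : realType) (M : wstarAlgType R) (E : wcorrType M).
Variables (H : hilbertType R) (sigma : M -> H -> H) (EH : htensor E sigma).
Variables (P : tensor_powers E) (TH : forall n, htensor (tp P n) sigma).
Variables (F : fock P) (FH : htensor F sigma).
Variables (FD : htensor F (ind_rep (Y := EH))).
Variable eta : H -> EH.

(* E^n (x) H as a summand of F(E) (x) H *)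
Definition summand n : TH n -> FH :=
  ht_lift (fun x h => ht FH (fock_in F x) h).

(* I_n (x) T *)
Definition id_tensor n (T : H -> H) : TH n -> TH n :=
  ht_lift (fun x h => ht (TH n) x (T h)).

(* d |-> x (x) d, with E^n (x) (E (x) H) identified with E^n.+1 (x) H *)
Definition tensor_assoc n (x : tp P n) : EH -> TH n.+1 :=
  ht_lift (fun e h => ht (TH n.+1) (tpS x e) h).

(* I_n (x) eta *)
Definition id_tensor_eta n : TH n -> TH n.+1 :=
  ht_lift (fun x h => tensor_assoc x (eta h)).

(* eta^(n); for n = 0 it is the identification of H with M (x) H. *)
Fixpoint eta_pow n : H -> TH n :=
  if n is m.+1 then fun h => id_tensor_eta (eta_pow m h)
  else fun h => ht (TH 0) (tp_unit P aone) h.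

(* x (x) e_0 (x) ... (x) e_(i-1); the index i + j makes it well typed. *)
Fixpoint tensor_word j (x : tp P j) (e : nat -> E) i : tp P (i + j) :=
  if i is k.+1 then tpS (tensor_word x e k) (e k) else x.

(* e_0 (x) ... (x) e_(i-1) *)
Fixpoint word (e : nat -> E) i : tp P i :=
  if i is k.+1 then tpS (word e k) (e k) else tp_unit P aone.

(* y |-> x (x) y, with E^j (x) (E^i (x) H) identified with E^(i+j) (x) H;
   the vectors word e i (x) h are total in E^i (x) H. *)
Definition ltensor j (x : tp P j) i : TH i -> TH (i + j) :=
  xget (fun=> 0) [set T : TH i -> TH (i + j) | bounded_op T /\
    forall e h, T (ht (TH i) (word e i) h) = ht (TH (i + j)) (tensor_word x e i) h].

(* y |-> x (x) y on F(E) (x) H *)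
Definition fock_ltensor j (x : tp P j) : FH -> FH :=
  xget (fun=> 0) [set T : FH -> FH | bounded_op T /\
    forall i (y : TH i), T (summand y) = summand (ltensor x y)].

Definition defect_star : H -> H := psqrt (fun h => h - adj eta (eta h)).

Definition defect : EH -> EH := psqrt (fun d => d - eta (adj eta d)).

Definition poisson (h : H) : FH :=
  limn (series (fun k => summand (id_tensor defect_star (eta_pow k h)))).

(* I_1 (x) eta^(m), where e in E is identified with 1 (x) e in tp 1 *)
Definition id1_tensor_eta_pow m : EH -> TH (m + 1) :=
  ht_lift (fun e h => ltensor (tpS (tp_unit P aone) e) (eta_pow m h)).

(* The term of index m of the series lies in E^(m+1) (x) H; for m = 0,
   eta^(0) = I and it is (I_1 (x) defect_star) (defect d). *)
Definition theta (d : EH) : FH :=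
  summand (ht (TH 0) (tp_unit P aone) (- adj eta d)) +
  limn (series (fun m =>
    summand (id_tensor defect_star (id1_tensor_eta_pow m (defect d))))).

(* It suffices to prescribe Theta on x (x) d with x in a summand E^j. *)
Definition char_op : FD -> FH :=
  xget (fun=> 0) [set T : FD -> FH | bounded_op T /\
    forall j (x : tp P j) (d : EH),
      T (ht FD (fock_in F x) d) = fock_ltensor x (theta d)].

End Poisson.

(* Main.v *)
(* Let N be I (x) eta, viewed as an operator on F(E) (x) H raising the degree by one, N' its
   adjoint, D_* = (I - N'N)^(1/2) and D = (I - NN')^(1/2).  Then |N| < 1, and K(eta) and
   Theta_eta are the restrictions to degree zero and to its orthogonal complement, which is
   F(E) (x) (E (x) H), of the Moebius transform W = - N' + D_* (I - N)^-1 D.  Since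
   N D_* = D N, the identity I - NN' = (I - N)(I - N') + N (I - N') + (I - N) N' gives
   W W' = I, and W W' = K K' + Theta Theta'. *)
Require Import Defs.
From HB Require Import structures.
From mathcomp Require Import all_boot all_order all_algebra.
From mathcomp Require Import all_classical all_reals all_analysis.
From mathcomp Require Import complex.

Set Implicit Arguments.
Unset Strict Implicit.
Unset Printing Implicit Defensive.
Import Order.TTheory GRing.Theory Num.Theory numFieldNormedType.Exports.
Local Open Scope classical_set_scope.
Local Open Scope complex_scope.
Local Open Scope ring_scope.

(** Adjoints, roots, lifts, left creation and [char_op] are chosen by [xget] with default 0. Each
    must first be matched with a bounded operator built by hand, so most of the work is existence.
    Two obstacles shape it. Simple tensors of correspondences are total only in the weak-* topology;
    normality of sigma and of the left action turns this into norm density after tensoring with a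
    Hilbert space. And a map prescribed on simple tensors must be bounded from its Gram kernel
    alone, which the [extend] lemmas do.

    W itself is never formed. N is factored as S (I (x) eta), where I (x) eta maps [FH] to [FD] and
    S is an isometry of [FD] onto the complement of degree zero. The splitting of W W' into K K' and
    Theta Theta' is S S' + V V' = I, with V the inclusion of H in degree zero. The formula for theta
    on [EH] propagates to [FD] because left creation operators commute with N and with D_*. *)

Lemma subrACA (V : zmodType) (a b c d : V) : (a - b) - (c - d) = (a - c) - (b - d).
Proof. by rewrite opprD addrACA -opprD. Qed.

(** * Closed spans and bounded operators *)

Section Scalars.
Variable R : realType.
Local Notation C := R[i].

(** Nonnegative elements of [R[i]] are real, so all three constants descend to R, where the powers
    of c tend to 0. Comparing with K + 1 avoids dividing by K = 0. *)
Lemma geo_small (c K e : C) : 0 <= c -> c < 1 -> 0 <= K -> 0 < e ->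
  exists N, forall n, (N <= n)%N -> K * c ^+ n < e.
Proof.
move=> c0 c1 K0 e0.
have rE (z : C) : 0 <= z -> z = (complex.Re z)%:C.
  by case: z => a b; rewrite lecE /= => /andP[/eqP -> _].
have [[cE KE] eE] := (rE _ c0, rE _ K0, rE _ (ltW e0)).
move: c0 c1 K0 e0; rewrite cE KE eE.
move: (complex.Re c) (complex.Re K) (complex.Re e) => {cE KE eE} {c}c {K}K {e}e.
rewrite !lecR !ltcR => c0 c1 K0 e0.
have ce : (GRing.exp c : R ^nat) x @[x --> \oo] --> 0.
  by apply: cvg_expr; rewrite ger0_norm.
have K1 : 0 < K + 1 by rewrite ltr_wpDl.
have /cvgr_dist_lt /(_ (e / (K + 1))) := ce.
move=> /(_ (divr_gt0 e0 K1))[N _ HN]; exists N => n /HN /=.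
rewrite sub0r normrN ger0_norm ?exprn_ge0// -rmorphXn -rmorphM/= ltcR.
rewrite ltr_pdivlMr// => h; apply: le_lt_trans h; rewrite mulrC.
by rewrite ler_wpM2l ?exprn_ge0// lerDl.
Qed.

(** The order of [R[i]] is partial; reality of x and y is what allows negating the conclusion, and e
    = (x - y) / (K + 1) then gives a contradiction. *)
Lemma le_eps (x y K : C) : x \is Num.real -> y \is Num.real -> 0 <= K ->
  (forall e, 0 < e -> x <= y + K * e) -> x <= y.
Proof.
move=> xr yr K0 h; rewrite real_leNgt//; apply/negP => yx.
have e0 : 0 < (x - y) / (K + 1) by rewrite divr_gt0 ?subr_gt0// ltr_wpDl.
have K1 : 0 < K + 1 by rewrite ltr_wpDl.
have := h _ e0; rewrite -lerBlDl mulrA ler_pdivlMr// mulrC mulrDl mul1r.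
by rewrite gerDl subr_le0 => /(lt_le_trans yx); rewrite ltxx.
Qed.

(** Turns a bound p * |h|^2 on a squared norm into the bound (p + 1) * |h| on the norm, without a
    square root of p. *)
Lemma le_sqrD1 (x : C) : 0 <= x -> x <= (x + 1) ^+ 2.
Proof.
move=> x0; have x1 : 1 <= x + 1 by rewrite lerDr.
by apply: (@le_trans _ _ (x + 1)); rewrite ?lerDl// expr2 ler_peMl// (le_trans ler01).
Qed.
End Scalars.

Section ClosedSpan.

Variable R : realType.
Local Notation C := R[i].

Lemma in_closure (V : normedModType C) (A : set V) x :
  closure A x <-> forall e, 0 < e -> exists2 a, A a & `|x - a| < e.
Proof.
split=> [cx e e0|h B].
  have [a [Aa]] := cx _ (nbhsx_ballx x e e0).
  by rewrite -ball_normE /= => xa; exists a.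
move=> /nbhs_ballP[e /= e0 eB]; have [a Aa xa] := h e e0.
by exists a; split => //; apply: eB; rewrite -ball_normE.
Qed.

Section LmodSpan.
Variable V : lmodType C.
Implicit Type S : set V.

Lemma lspan_gen S s : S s -> lspan S s.
Proof.
by move=> Ss; exists 1%N, (fun=> 1), (fun=> s); split=> //; rewrite big_ord1 scale1r.
Qed.

Lemma lspan_linear S c u v : lspan S u -> lspan S v -> lspan S (c *: u + v).
Proof.
move=> [n [a [s [Ss ->]]]] [m [b [t [St ->]]]].
exists (n + m)%N,
  (fun k : 'I_(n + m) => match fintype.split k with inl i => c * a i | inr j => b j end),
  (fun k : 'I_(n + m) => match fintype.split k with inl i => s i | inr j => t j end).
split=> [k|]; first by case: (fintype.split k).
rewrite big_split_ord scaler_sumr; congr (_ + _); apply: eq_bigr => i _ /=.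
  by rewrite (unsplitK (inl i)) scalerA.
by rewrite (unsplitK (inr i)).
Qed.

Lemma lspan0 S : lspan S 0.
Proof. by exists 0%N, (fun=> 0), (fun=> 0); split=> [[]//|]; rewrite big_ord0. Qed.

Lemma lspan_ind S (Q : V -> Prop) : Q 0 ->
  (forall c u v, Q u -> Q v -> Q (c *: u + v)) -> (forall s, S s -> Q s) ->
  forall v, lspan S v -> Q v.
Proof.
move=> Q0 Qlin QS v [n [c [s [Ss ->]]]].
by elim/big_rec: _ => // i x _ Qx; apply: Qlin => //; apply: QS.
Qed.

Lemma lspan_sub S T v : S `<=` lspan T -> lspan S v -> lspan T v.
Proof.
move=> ST; apply: lspan_ind; [exact: lspan0|move=> *; exact: lspan_linear|exact: ST].
Qed.
End LmodSpan.

Section NormSpan.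
Variable V : normedModType C.
Implicit Type S : set V.

Lemma closure_linear S : (forall c u v, S u -> S v -> S (c *: u + v)) ->
  forall c u v, closure S u -> closure S v -> closure S (c *: u + v).
Proof.
move=> Sl c u v /in_closure Su /in_closure Sv; apply/in_closure => e e0.
have c1 : 0 < `|c| + 1 by rewrite ltr_wpDl.
have [a Sa ua] := Su (e / 2 / (`|c| + 1)) (divr_gt0 (divr_gt0 e0 (ltr0n _ 2)) c1).
have [b Sb vb] := Sv (e / 2) (divr_gt0 e0 (ltr0n _ 2)).
exists (c *: a + b); first exact: Sl.
have -> : c *: u + v - (c *: a + b) = c *: (u - a) + (v - b).
  by rewrite scalerBr opprD addrACA.
apply: le_lt_trans (ler_normD _ _) _; rewrite normrZ [ltRHS](splitr e).
apply: ler_ltD => //; move: ua; rewrite ltr_pdivlMr// mulrC => /ltW; apply: le_trans.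
by rewrite ler_wpM2r// lerDl.
Qed.

Lemma closure_closure (S : set V) v : closure (closure S) v -> closure S v.
Proof. by rewrite -(closure_id _).1//; exact: closed_closure. Qed.

Lemma cspan_ind S (Q : V -> Prop) : Q 0 ->
  (forall c u v, Q u -> Q v -> Q (c *: u + v)) -> (forall s, S s -> Q s) ->
  (forall v, closure Q v -> Q v) -> forall v, closure (lspan S) v -> Q v.
Proof.
move=> Q0 Ql QS Qc v cv; apply: Qc.
by apply: closure_subset cv => w; apply: lspan_ind.
Qed.

Lemma cspan_sub S T v : S `<=` closure (lspan T) ->
  closure (lspan S) v -> closure (lspan T) v.
Proof.
move=> ST; apply: cspan_ind => //; last exact: closure_closure.
- exact/subset_closure/lspan0.
- by move=> *; apply: closure_linear => // *; exact: lspan_linear.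
Qed.
End NormSpan.
End ClosedSpan.

(** Bundling removes side conditions from linearity rewrites; the coercion lets a bundled operator
    stand for the bare functions used in the definitions. *)
Record bop (R : realType) (U V : normedModType R[i]) :=
  Bop { bop_fun :> U -> V; bopP : bounded_op bop_fun }.

Section BoundedOps.
Variable R : realType.
Local Notation C := R[i].
Implicit Types U V W : normedModType C.

Section Linear.
Variables (U V : normedModType C) (T : bop U V).

Lemma bop_linear c u v : T (c *: u + v) = c *: T u + T v.
Proof. exact: (bopP T).1. Qed.

Lemma bopD u v : T (u + v) = T u + T v.
Proof. by rewrite -[u]scale1r bop_linear !scale1r. Qed.

Lemma bop0 : T 0 = 0.
Proof. by apply: (addIr (T 0)); rewrite -bopD !add0r. Qed.

Lemma bopZ c u : T (c *: u) = c *: T u.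
Proof. by rewrite -[c *: u]addr0 bop_linear bop0 addr0. Qed.

Lemma bopN u : T (- u) = - T u.
Proof. by rewrite -scaleN1r bopZ scaleN1r. Qed.

Lemma bopB u v : T (u - v) = T u - T v.
Proof. by rewrite bopD bopN. Qed.

Lemma bop_sum I (r : seq I) Q (F : I -> U) :
  T (\sum_(i <- r | Q i) F i) = \sum_(i <- r | Q i) T (F i).
Proof. exact: (big_morph T bopD bop0). Qed.
End Linear.

(** The constant in [bounded_op] is an arbitrary complex number. Since c * |x| dominates a norm it
    is nonnegative, hence at most |c| * |x|. *)
Lemma bounded_opP U V (T : U -> V) : bounded_op T <->
  linear T /\ exists2 c : C, 0 <= c & forall x, `|T x| <= c * `|x|.
Proof.
split=> -[lT]; last by move=> [c _ cT]; split=> //; exists c.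
move=> [c cT]; split=> //; exists `|c| => // x.
have := cT x; rewrite -[X in _ -> _ <= _ * X]normr_id -normrM.
move=> h; apply: le_trans h _; apply: real_ler_norm.
by have := le_trans (normr_ge0 _) (cT x); exact: ger0_real.
Qed.

Lemma bop_bound U V (T : bop U V) :
  exists2 c : C, 0 <= c & forall x, `|T x| <= c * `|x|.
Proof. by case/bounded_opP: (bopP T). Qed.

Lemma bop_bound_gt0 U V (T : bop U V) :
  exists2 c : C, 0 < c & forall x, `|T x| <= c * `|x|.
Proof.
have [c c0 cT] := bop_bound T; exists (c + 1); first by rewrite ltr_wpDl.
by move=> x; apply: le_trans (cT x) _; rewrite ler_wpM2r// lerDl.
Qed.

Lemma bounded_comp U V W (S : bop V W) (T : bop U V) : bounded_op (S \o T).
Proof.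
have [[c c0 cS] [d d0 dT]] := (bop_bound S, bop_bound T).
apply/bounded_opP; split=> [a u v /=|]; first by rewrite !bop_linear.
exists (c * d) => [|x /=]; first exact: mulr_ge0.
by apply: le_trans (cS _) _; rewrite -mulrA ler_wpM2l.
Qed.

Lemma bounded_id U : bounded_op (@id U).
Proof. by apply/bounded_opP; split=> //; exists 1 => // x; rewrite mul1r. Qed.

Lemma bounded_cst0 U V : bounded_op (fun _ : U => 0 : V).
Proof.
apply/bounded_opP; split=> [a u v|]; first by rewrite scaler0 addr0.
by exists 0 => // x; rewrite normr0 mul0r.
Qed.

Lemma bounded_lin U V (a : C) (S T : bop U V) : bounded_op (fun x => a *: S x + T x).
Proof.
have [[c c0 cS] [d d0 dT]] := (bop_bound S, bop_bound T).
apply/bounded_opP; split=> [b u v|].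
  rewrite !bop_linear !scalerDr !scalerA [a * b]mulrC -!addrA.
  by congr (_ + _); rewrite addrCA.
exists (`|a| * c + d) => [|x]; first by rewrite addr_ge0// mulr_ge0.
apply: le_trans (ler_normD _ _) _; rewrite normrZ mulrDl lerD// -mulrA.
by rewrite ler_wpM2l.
Qed.

Definition bop_comp U V W (S : bop V W) (T : bop U V) := Bop (bounded_comp S T).
Definition bop_id U := Bop (bounded_id U).
Definition bop_zero U V := Bop (bounded_cst0 U V).
Definition bop_lin U V a (S T : bop U V) := Bop (bounded_lin a S T).
Definition bop_sub U V (S T : bop U V) := bop_lin (-1) T S.

Lemma bop_subE U V (S T : bop U V) x : bop_sub S T x = S x - T x.
Proof. by rewrite /= scaleN1r addrC. Qed.

Lemma closure_bop U V (T : bop U V) (A : set U) (B : set V) x :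
  (forall a, A a -> B (T a)) -> closure A x -> closure B (T x).
Proof.
move=> AB /in_closure cA; apply/in_closure => e e0.
have [c c0 cT] := bop_bound_gt0 T.
have [a Aa xa] := cA (e / c) (divr_gt0 e0 c0).
exists (T a); first exact: AB.
rewrite -bopB; apply: le_lt_trans (cT _) _.
by rewrite mulrC -ltr_pdivlMr.
Qed.

Lemma closure_eq0 V (x : V) : closure [set 0] x -> x = 0.
Proof.
move=> /in_closure cx; apply/eqP; rewrite -normr_eq0 eq_le normr_ge0 andbT.
apply: (@le_eps _ _ _ 1) => // e e0; have [_ -> ] := cx _ e0.
by rewrite subr0 add0r mul1r => /ltW.
Qed.

Lemma bop_cspan U V (S T : bop U V) (A : set U) x :
  (forall a, A a -> S a = T a) -> closure (lspan A) x -> S x = T x.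
Proof.
move=> ST; apply: (@cspan_ind _ _ A (fun x => S x = T x)) => //.
- by rewrite !bop0.
- by move=> c u v /= Su Sv; rewrite !bop_linear Su Sv.
move=> v cv; apply/eqP; rewrite -subr_eq0 -bop_subE; apply/eqP/closure_eq0.
by apply: closure_bop cv => a /= ->; rewrite scaleN1r addNr.
Qed.

Lemma bop_eq U V (S T : bop U V) (A : set U) : closure (lspan A) = setT ->
  (forall a, A a -> S a = T a) -> S =1 T.
Proof. by move=> tA ST x; apply: bop_cspan ST _; rewrite tA. Qed.
End BoundedOps.

(** * Infima and geometric convergence with explicit rates *)

Section Completeness.
Variable R : realType.
Local Notation C := R[i].

(** The infimum is taken over real parts, which determine the elements of a set of nonnegative
    complex numbers. *)
Lemma nonneg_inf (A : set C) : A !=set0 -> (forall a, A a -> 0 <= a) ->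
  exists2 d : C, 0 <= d & (forall a, A a -> d <= a) /\
    (forall e, 0 < e -> exists2 a, A a & a < d + e).
Proof.
move=> [a0 Aa0] A0.
have rE (z : C) : 0 <= z -> z = (complex.Re z)%:C.
  by case: z => a b; rewrite lecE /= => /andP[/eqP -> _].
pose B := [set complex.Re a | a in A].
have B0 b : B b -> 0 <= b by move=> [a Aa <-]; rewrite -lecR -rE; exact: A0.
have hB : has_inf B by split; [exists (complex.Re a0), a0|exists 0 => b /B0].
exists (inf B)%:C; first by rewrite lecR; apply: lb_le_inf => [|b /B0//]; exact: hB.1.
split=> [a Aa|e e0].
  by rewrite (rE _ (A0 _ Aa)) lecR; apply: ge_inf; [exact: hB.2|exists a].
have e1 : 0 < complex.Re e by rewrite -ltcR -rE// ltW.
have [_ [a Aa <-] ae] := inf_adherent e1 hB.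
by exists a => //; rewrite (rE _ (A0 _ Aa)) (rE _ (ltW e0)) -rmorphD/= ltcR.
Qed.

Lemma geo_cauchy (V : normedModType C) (f : nat -> V) (c K : C) :
  0 <= c -> c < 1 -> (forall n, `|f n.+1 - f n| <= K * c ^+ n) ->
  forall n m, (n <= m)%N -> `|f m - f n| <= K / (1 - c) * c ^+ n.
Proof.
move=> c0 c1 fK n m /subnK <-; set k := (m - n)%N; rewrite addnC.
have K0 : 0 <= K by have := le_trans (normr_ge0 _) (fK 0%N); rewrite expr0 mulr1.
have c10 : 0 < 1 - c by rewrite subr_gt0.
(* The partial geometric sum: keeping the factor 1 - c ^+ k is what lets the induction on k
   close. *)
suff h : `|f (n + k)%N - f n| <= K / (1 - c) * c ^+ n * (1 - c ^+ k).
  apply: le_trans h _; rewrite -[leRHS]mulr1 ler_wpM2l//.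
    by rewrite mulr_ge0 ?exprn_ge0// divr_ge0// ltW.
  by rewrite gerBl exprn_ge0.
elim: k => [|k IH]; first by rewrite addn0 subrr normr0 expr0 subrr mulr0.
rewrite addnS -[f _ - _](subrKA (f (n + k)%N)).
apply: le_trans (ler_normD _ _) _; apply: le_trans (lerD (fK _) IH) _.
rewrite exprD -!mulrA -mulrDr ler_wpM2l//.
rewrite [(1 - c)^-1 * (_ * (1 - c ^+ k.+1))]mulrCA [(1 - c)^-1 * (_ * _)]mulrCA.
rewrite -mulrDr ler_wpM2l ?exprn_ge0//.
have -> : 1 - c ^+ k.+1 = (1 - c) * c ^+ k + (1 - c ^+ k).
  by rewrite exprS mulrBl mul1r [RHS]addrC subrKA.
by rewrite [leRHS]mulrDr mulKf// gt_eqF.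
Qed.

Lemma geo_cvg (V : completeNormedModType C) (f : nat -> V) (c K : C) :
  0 <= c -> c < 1 -> (forall n, `|f n.+1 - f n| <= K * c ^+ n) ->
  exists2 l : V, f x @[x --> \oo] --> l &
    forall n, `|l - f n| <= K / (1 - c) * c ^+ n.
Proof.
move=> c0 c1 fK; have fm := geo_cauchy c0 c1 fK.
have K0 : 0 <= K by have := le_trans (normr_ge0 _) (fK 0%N); rewrite expr0 mulr1.
have K1 : 0 <= K / (1 - c) by rewrite divr_ge0// subr_ge0 ltW.
have fc : cvg (f x @[x --> \oo]).
  apply/cauchy_cvgP/cauchy_exP => e e0.
  have [N hN] := geo_small c0 c1 K1 e0; exists (f N).
  exists N => // n /= Nn; rewrite -ball_normE /= distrC.
  exact: le_lt_trans (fm _ _ Nn) (hN _ (leqnn _)).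
exists (lim (f x @[x --> \oo])) => // n.
apply: (@le_eps _ _ _ 1) => //; first by rewrite ger0_real// mulr_ge0 ?exprn_ge0.
move=> e e0; have /cvgr_dist_lt /(_ _ e0) [N _ hN] := fc.
have /= h1 := hN (maxn N n) (leq_maxl _ _).
have h2 := fm n (maxn N n) (leq_maxr _ _).
rewrite mul1r [leRHS]addrC -[_ - f n](subrKA (f (maxn N n))).
by apply: le_trans (ler_normD _ _) (lerD (ltW h1) h2).
Qed.

(** Serves as the calculus of limits: an identity between two limits follows once both sides are
    approached by one sequence at rate c ^+ n. Square roots and Neumann series are handled this
    way. *)
Lemma geo_unique (V : normedModType C) (f : nat -> V) (c K K' : C) l l' :
  0 <= c -> c < 1 -> 0 <= K -> 0 <= K' ->
  (forall n, `|l - f n| <= K * c ^+ n) -> (forall n, `|l' - f n| <= K' * c ^+ n) ->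
  l = l'.
Proof.
move=> c0 c1 K0 K0' fl fl'; apply/eqP; rewrite -subr_eq0 -normr_eq0 eq_le normr_ge0 andbT.
apply: (@le_eps _ _ _ 1) => // e e0; rewrite add0r mul1r.
have [N /(_ _ (leqnn _)) hN] := geo_small c0 c1 (addr_ge0 K0 K0') e0.
apply: le_trans (ltW hN); rewrite mulrDl -[l - l'](subrKA (f N)).
apply: le_trans (ler_normD _ _) (lerD (fl N) _).
by rewrite distrC.
Qed.

Lemma geo_cvgP (V : normedModType C) (f : nat -> V) (c K : C) l :
  0 <= c -> c < 1 -> 0 <= K ->
  (forall n, `|l - f n| <= K * c ^+ n) -> f x @[x --> \oo] --> l.
Proof.
move=> c0 c1 K0 fl; apply/cvgrPdist_lt => e e0.
have [N hN] := geo_small c0 c1 K0 e0.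
by exists N => // n /hN; apply: le_lt_trans.
Qed.
End Completeness.

(** * Hilbert spaces: projections, adjoints, square roots *)

Section Dot.
Variables (R : realType) (V : hilbertType R).
Local Notation C := R[i].
Implicit Types u w x y z : V.

Lemma dotDr x y z : dot x (y + z) = dot x y + dot x z.
Proof. by rewrite -[y]scale1r dot_linear mul1r scale1r. Qed.

Lemma dot0r x : dot x 0 = 0.
Proof. by apply: (addIr (dot x 0)); rewrite -dotDr !add0r. Qed.

Lemma dotZr c x y : dot x (c *: y) = c * dot x y.
Proof. by rewrite -[c *: y]addr0 dot_linear dot0r addr0. Qed.

Lemma dotNr x y : dot x (- y) = - dot x y.
Proof. by rewrite -scaleN1r dotZr mulN1r. Qed.

Lemma dotBr x y z : dot x (y - z) = dot x y - dot x z.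
Proof. by rewrite dotDr dotNr. Qed.

Lemma dotDl x y z : dot (x + y) z = dot x z + dot y z.
Proof. by rewrite dot_conj dotDr rmorphD /= -!dot_conj. Qed.

Lemma dotZl c x y : dot (c *: x) y = c^* * dot x y.
Proof. by rewrite dot_conj dotZr rmorphM /= -dot_conj. Qed.

Lemma dot0l x : dot 0 x = 0.
Proof. by rewrite dot_conj dot0r rmorph0. Qed.

Lemma dotNl x y : dot (- x) y = - dot x y.
Proof. by rewrite -scaleN1r dotZl rmorphN1 mulN1r. Qed.

Lemma dotBl x y z : dot (x - y) z = dot x z - dot y z.
Proof. by rewrite dotDl dotNl. Qed.

Lemma dot_eq0 x : dot x x = 0 -> x = 0.
Proof. by move=> /eqP; rewrite dot_norm sqrf_eq0 normr_eq0 => /eqP. Qed.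

Lemma dot_inj x y : (forall z, dot z x = dot z y) -> x = y.
Proof.
by move=> h; apply/eqP; rewrite -subr_eq0; apply/eqP/dot_eq0; rewrite dotBr h subrr.
Qed.

(** Nonnegativity of the right-hand side is Cauchy-Schwarz; comparing it with an infimum of squared
    distances gives near orthogonality in [projection]. *)
Lemma dist_line u w : u != 0 ->
  `|w - (dot u w / `|u| ^+ 2) *: u| ^+ 2 = `|w| ^+ 2 - `|dot u w| ^+ 2 / `|u| ^+ 2.
Proof.
move=> u0; have nu : `|u| ^+ 2 != 0 by rewrite sqrf_eq0 normr_eq0.
rewrite -!dot_norm dotBr !dotBl !dotZr !dotZl [dot w u]dot_conj dot_norm.
have -> : (dot u w / dot u u)^* = (dot u w)^* / dot u u.
  by rewrite rmorphM fmorphV /= -[X in _ / X]dot_conj.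
rewrite !dot_norm normCK divfK// -addrA; congr (_ + _).
by rewrite subrr subr0 mulrAC [_^* * _]mulrC.
Qed.

Lemma cauchy_schwarz x y : `|dot x y| <= `|x| * `|y|.
Proof.
have [->|x0] := eqVneq x 0; first by rewrite dot0l !normr0 mul0r.
have nx : 0 < `|x| ^+ 2 by rewrite exprn_gt0// normr_gt0.
have := exprn_ge0 2 (normr_ge0 (y - (dot x y / `|x| ^+ 2) *: x)); rewrite dist_line// => h.
rewrite -(@ler_pXn2r _ 2)// ?nnegrE ?mulr_ge0// exprMn mulrC -ler_pdivrMr//.
by rewrite -subr_ge0.
Qed.

End Dot.

Section Projection.
Variables (R : realType).
Local Notation C := R[i].

(** Take y n in the span whose squared distance to v exceeds the infimum by less than (q ^+ n) ^+ 2.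
    Moving y n along any u of the span shows that v - y n is orthogonal to u up to q ^+ n * |u|.
    This one estimate gives convergence and, in the limit, orthogonality. *)
Lemma projection (V : hilbertType R) (S : set V) (v : V) :
  exists2 p, closure (lspan S) p & forall s, S s -> dot s (v - p) = 0.
Proof.
pose A := [set a : C | exists2 y, lspan S y & a = `|v - y| ^+ 2].
have [||d d0 [dA Ad]] := @nonneg_inf _ A.
- by exists (`|v - 0| ^+ 2), 0 => //; exact: lspan0.
- by move=> _ [y _ ->]; rewrite exprn_ge0.
pose q : C := 2^-1.
have q0 : 0 < q by rewrite invr_gt0.
have q1 : q < 1 by rewrite invf_lt1// ltr1n.
have qn n : 0 < (q ^+ n) ^+ 2 by rewrite !exprn_gt0.
have /choice[y hy] n : exists y, lspan S y /\ `|v - y| ^+ 2 < d + (q ^+ n) ^+ 2.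
  by have [_ [y Sy ->] ?] := Ad _ (qn n); exists y.
have near_orth n u : lspan S u -> `|dot u (v - y n)| <= q ^+ n * `|u|.
  move=> Su; have [->|u0] := eqVneq u 0; first by rewrite dot0l !normr0 mulr0.
  have [Sy yn] := hy n; set w := v - y n; set t := dot u w / `|u| ^+ 2.
  have : d <= `|w - t *: u| ^+ 2.
    apply: dA; exists (t *: u + y n); first exact: lspan_linear.
    by rewrite /w opprD addrA addrAC.
  rewrite dist_line// lerBrDl => h.
  have nu : 0 < `|u| ^+ 2 by rewrite exprn_gt0// normr_gt0.
  rewrite -(@ler_pXn2r _ 2)// ?nnegrE ?mulr_ge0// ?exprn_ge0 ?(ltW q0)//.
  rewrite exprMn -ler_pdivrMr//.
  by have := le_lt_trans h yn; rewrite addrC ltrD2l => /ltW.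
(* Near orthogonality is tested on the increment u itself, because |u|^2 = <u, v - y n> - <u, v - y
   n.+1>. *)
have ylip n : `|y n.+1 - y n| <= (1 + q) * q ^+ n.
  have [->|u0] := eqVneq (y n.+1 - y n) 0.
    by rewrite normr0 mulr_ge0 ?exprn_ge0 ?addr_ge0 ?ltW.
  have nu : 0 < `|y n.+1 - y n| by rewrite normr_gt0.
  set u := y n.+1 - y n in u0 nu *.
  have Su : lspan S u.
    by rewrite /u addrC -scaleN1r; apply: lspan_linear; case: (hy n); case: (hy n.+1).
  rewrite -(ler_pM2r nu) -expr2.
  have <- : `|dot u u| = `|u| ^+ 2 by rewrite dot_norm normrX normr_id.
  have -> : dot u u = dot u (v - y n) - dot u (v - y n.+1).
    by rewrite -dotBr opprB [v - y n + _]addrC addrA subrK.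
  apply: le_trans (ler_normB _ _) _.
  apply: le_trans (lerD (near_orth _ _ Su) (near_orth _ _ Su)) _.
  by rewrite exprS -mulrDl [(1 + q) * _]mulrDl mul1r.
have [p yp py] := geo_cvg (ltW q0) q1 ylip.
exists p.
  apply/in_closure => e e0; have /cvgr_dist_lt /(_ _ e0)[N _ hN] := yp.
  by exists (y N); [case: (hy N)|exact: (hN N (leqnn N))].
move=> s Ss; apply/eqP; rewrite -normr_eq0 eq_le normr_ge0 andbT.
pose K := (1 + q) / (1 - q).
have K0 : 0 <= K by rewrite divr_ge0 ?subr_ge0 ?(ltW q1)// addr_ge0 ?(ltW q0).
apply: (@le_eps _ _ _ 1) => // e e0; rewrite add0r mul1r.
have K1 : 0 <= `|s| * (1 + K) by rewrite mulr_ge0// addr_ge0.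
have [n /(_ _ (leqnn _)) hn] := geo_small (ltW q0) q1 K1 e0.
apply: le_trans (ltW hn).
have -> : v - p = (v - y n) - (p - y n) by rewrite opprB addrA subrK.
rewrite dotBr; apply: le_trans (ler_normB _ _) _.
rewrite mulrDr mulr1 mulrDl [`|s| * q ^+ n]mulrC -mulrA.
apply: lerD; first exact/near_orth/lspan_gen.
by apply: le_trans (cauchy_schwarz _ _) _; rewrite ler_wpM2l.
Qed.
End Projection.

Section Adjoint.
Variable R : realType.
Local Notation C := R[i].

Lemma riesz (V : hilbertType R) (f : V -> C) (K : C) :
  (forall c x y, f (c *: x + y) = c * f x + f y) -> 0 <= K ->
  (forall x, `|f x| <= K * `|x|) -> exists z, forall x, f x = dot z x.
Proof.
move=> fl K0 fK.
have fD x y : f (x + y) = f x + f y by rewrite -[x]scale1r fl mul1r scale1r.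
have f0 : f 0 = 0 by apply: (addIr (f 0)); rewrite -fD !add0r.
have fZ c x : f (c *: x) = c * f x by rewrite -[c *: x]addr0 fl f0 addr0.
have fB x y : f (x - y) = f x - f y by rewrite fD -scaleN1r fZ mulN1r.
have [h|/existsNP[v fv]] := pselect (forall x, f x = 0).
  by exists 0 => x; rewrite dot0l.
have [p pS pv] := projection [set x | f x = 0] v.
have fp : f p = 0.
  apply/eqP; rewrite -normr_eq0 eq_le normr_ge0 andbT.
  apply: (@le_eps _ _ _ K) => // e e0; have [a Sa pa] := (in_closure _ _).1 pS e e0.
  have fa : f a = 0.
    apply: (@lspan_ind _ _ _ (fun a => f a = 0) f0 _ _ _ Sa) => // c u w fu fw.
    by rewrite fl fu fw mulr0 addr0.
  rewrite add0r -[f p]subr0 -fa -fB; apply: le_trans (fK _) _.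
  by rewrite ler_wpM2l// ltW.
set w := v - p in pv; have fw : f w = f v by rewrite fB fp subr0.
have fw0 : f w != 0 by rewrite fw; apply/eqP.
have w0 : w != 0 by apply: contra_neq fw0 => ->.
have nw : `|w| ^+ 2 != 0 by rewrite sqrf_eq0 normr_eq0.
exists ((f w / `|w| ^+ 2)^* *: w) => x; rewrite dotZl conjCK.
have := pv (x - (f x / f w) *: w); rewrite /= fB fZ divfK// subrr => /(_ erefl).
rewrite dot_conj => /eqP; rewrite conjC_eq0 dotBr dotZr dot_norm subr_eq0 => /eqP ->.
by rewrite mulrCA -[X in _ * X]mulrA mulVf// mulr1 divfK.
Qed.

Section Adj.
Variables (U V : hilbertType R).

Lemma adj_bound (T : U -> V) (S : V -> U) c : 0 <= c ->
  (forall x y, dot (T x) y = dot x (S y)) -> (forall x, `|T x| <= c * `|x|) ->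
  forall y, `|S y| <= c * `|y|.
Proof.
move=> c0 TS cT y; have [->|Sy0] := eqVneq (S y) 0; first by rewrite normr0 mulr_ge0.
have nS : 0 < `|S y| by rewrite normr_gt0.
rewrite -(ler_pM2r nS) -expr2.
have <- : `|dot (T (S y)) y| = `|S y| ^+ 2.
  by rewrite TS dot_norm normrX normr_id.
apply: le_trans (cauchy_schwarz _ _) _.
by rewrite mulrAC ler_wpM2r.
Qed.

Lemma adj_exists (T : bop U V) : exists S : V -> U,
  bounded_op S /\ forall x y, dot (T x) y = dot x (S y).
Proof.
have [c c0 cT] := bop_bound T.
have /choice[S hS] y : exists z, forall x, dot y (T x) = dot z x.
  apply: (@riesz _ (fun x => dot y (T x)) (`|y| * c)).
  - by move=> a u v; rewrite bop_linear dot_linear.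
  - by rewrite mulr_ge0.
  - by move=> x; apply: le_trans (cauchy_schwarz _ _) _; rewrite -mulrA ler_wpM2l.
have TS x y : dot (T x) y = dot x (S y) by rewrite dot_conj hS -dot_conj.
exists S; split=> //; apply/bounded_opP; split; last first.
  by exists c => //; exact: adj_bound c0 TS cT.
by move=> a u v; apply: dot_inj => x; rewrite dot_linear -!TS dot_linear.
Qed.

Lemma adjP (T : bop U V) : bounded_op (adj T) /\ forall x y, dot (T x) y = dot x (adj T y).
Proof. exact: (@xgetPex _ (fun=> 0) _ (adj_exists T)). Qed.

Definition adj_bop (T : bop U V) : bop V U := Bop (adjP T).1.

Lemma adj_bopE (T : bop U V) x y : dot (T x) y = dot x (adj_bop T y).
Proof. exact: (adjP T).2. Qed.

Lemma adj_bopEr (T : bop U V) x y : dot y (T x) = dot (adj_bop T y) x.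
Proof. by rewrite dot_conj adj_bopE -dot_conj. Qed.

End Adj.
End Adjoint.

Section SquareRoot.
Variable R : realType.
Local Notation C := R[i].

Section Iteration.
Variable V : completeNormedModType C.
Variable B : bop V V.

(* Converges to 1 - (1 - B)^(1/2) when |B| < 1. *)
Fixpoint sqrt_iter n : bop V V := if n is m.+1 then
    bop_lin 2^-1 (bop_comp (sqrt_iter m) (sqrt_iter m)) (bop_lin 2^-1 B (bop_zero V V))
  else bop_zero V V.

Lemma sqrt_iterS n x :
  sqrt_iter n.+1 x = 2^-1 *: (sqrt_iter n (sqrt_iter n x) + B x).
Proof. by rewrite /= addr0 scalerDr. Qed.
End Iteration.
Local Notation Y := sqrt_iter.

(** The iterates are polynomials in B whose coefficients do not depend on B, so T carries those of B
    to those of B'. *)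
Lemma sqrt_iter_intertwine (V W : completeNormedModType C) (B : bop V V)
    (B' : bop W W) (T : bop V W) : (forall x, T (B x) = B' (T x)) ->
  forall n x, T (Y B n x) = Y B' n (T x).
Proof.
move=> TB; elim=> [|n IH] x; first by rewrite /= bop0.
by rewrite !sqrt_iterS bopZ bopD TB !IH.
Qed.

Section Limit.
Variables (V : completeNormedModType C) (B : bop V V) (b : C).
Hypotheses (b0 : 0 <= b) (b1 : b < 1) (Bb : forall x, `|B x| <= b * `|x|).

Lemma sqrt_iter_comm m n x : Y B m (Y B n x) = Y B n (Y B m x).
Proof.
apply: sqrt_iter_intertwine => y; apply/esym; exact: sqrt_iter_intertwine.
Qed.

Let half (u v w : C) : u <= w -> v <= w -> 2^-1 * (u + v) <= w.
Proof.
by move=> uw vw; rewrite mulrC ler_pdivrMr ?ltr0n// mulr_natr mulr2n lerD.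
Qed.

(* The ball of radius b is stable because b + b ^+ 2 <= 2 * b. *)
Lemma sqrt_iter_bound n x : `|Y B n x| <= b * `|x|.
Proof.
elim: n x => [|n IH] x; first by rewrite /= normr0 mulr_ge0.
rewrite sqrt_iterS normrZ ger0_norm ?invr_ge0 ?ler0n//.
apply: le_trans (ler_wpM2l _ (ler_normD _ _)) _; first by rewrite invr_ge0 ler0n.
apply: half; last exact: Bb.
apply: le_trans (IH _) _.
rewrite ler_wpM2l//; apply: le_trans (IH _) _.
by rewrite ler_piMl// ltW.
Qed.

Lemma sqrt_iter_step n x : `|Y B n.+1 x - Y B n x| <= `|x| * b ^+ n.
Proof.
elim: n => [|n IH].
  rewrite sqrt_iterS /= add0r subr0 normrZ ger0_norm ?invr_ge0 ?ler0n// expr0 mulr1.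
  rewrite -[B x]add0r; apply: le_trans (ler_wpM2l _ (ler_normD _ _)) _.
    by rewrite invr_ge0 ler0n.
  apply: half; first by rewrite normr0.
  by apply: le_trans (Bb _) _; rewrite ler_piMl// ltW.
set d := Y B n.+1 x - Y B n x in IH.
(* Difference of squares: the iterates commute, so the increment is half of (Y n.+1 + Y n) applied
   to the previous one. Both factors have norm at most b, and so does their half sum. *)
have -> : Y B n.+2 x - Y B n.+1 x = 2^-1 *: (Y B n.+1 d + Y B n d).
  rewrite /d !bopB [Y B n.+1 (Y B n x)]sqrt_iter_comm subrKA.
  rewrite [in LHS]sqrt_iterS [in X in _ - X]sqrt_iterS -scalerBr.
  by rewrite opprD addrACA subrr addr0.
rewrite normrZ ger0_norm ?invr_ge0 ?ler0n//.
apply: le_trans (ler_wpM2l _ (ler_normD _ _)) _; first by rewrite invr_ge0 ler0n.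
rewrite exprS mulrCA.
by apply: half; apply: le_trans (sqrt_iter_bound _ _) _; rewrite ler_wpM2l.
Qed.

Definition sqrt_limit (L : V -> V) :=
  forall n x, `|L x - Y B n x| <= `|x| / (1 - b) * b ^+ n.

Lemma sqrt_limit_exists : exists L : bop V V, sqrt_limit L.
Proof.
have /choice[L hL] x : exists l, forall n, `|l - Y B n x| <= `|x| / (1 - b) * b ^+ n.
  by have [l _ hl] := geo_cvg b0 b1 (fun n => sqrt_iter_step n x); exists l.
have c0 (x : V) : 0 <= `|x| / (1 - b) :> C by rewrite divr_ge0// subr_ge0 ltW.
suff bL : bounded_op L by exists (Bop bL) => n x; exact: hL.
apply/bounded_opP; split=> [a u v|].
  apply: (@geo_unique _ _ (fun n => Y B n (a *: u + v)) b (`|a *: u + v| / (1 - b))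
    (`|a| * (`|u| / (1 - b)) + `|v| / (1 - b)) _ _ b0 b1 (c0 _) _ (hL _)).
    exact: (addr_ge0 (mulr_ge0 (normr_ge0 a) (c0 u)) (c0 v)).
  move=> n; rewrite bop_linear opprD addrACA -scalerBr mulrDl.
  apply: le_trans (ler_normD _ _) _; rewrite lerD//.
  by rewrite normrZ -mulrA ler_wpM2l.
exists (1 - b)^-1 => [|x]; first by rewrite invr_ge0 subr_ge0 ltW.
by have := hL x 0%N; rewrite /= subr0 expr0 mulr1 mulrC.
Qed.

Section Facts.
Variables (L : bop V V) (LY : sqrt_limit L).

Let c0 (x : V) : 0 <= `|x| / (1 - b) :> C.
Proof. by rewrite divr_ge0// subr_ge0 ltW. Qed.

Lemma sqrt_limit_bound x : `|L x| <= b * `|x|.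
Proof.
apply: (@le_eps _ _ _ 1) => //.
  by rewrite ger0_real// mulr_ge0.
move=> e e0; have [N /(_ _ (leqnn _)) hN] := geo_small b0 b1 (c0 x) e0.
rewrite mul1r [leRHS]addrC -[L x](subrK (Y B N x)).
apply: le_trans (ler_normD _ _) (lerD _ (sqrt_iter_bound _ _)).
by apply: le_trans (LY N x) (ltW hN).
Qed.

(** The recursion passes to the limit. As an operator equation, L = (L^2 + B) / 2 says that (1 -
    L)^2 = 1 - B. *)
Lemma sqrt_limit_eq x : L x = 2^-1 *: (L (L x) + B x).
Proof.
apply: (@geo_unique _ _ (fun n => Y B n.+1 x) b
  (`|x| / (1 - b)) (2^-1 * (`|L x| / (1 - b) + b * (`|x| / (1 - b)))) _ _ b0 b1) => //.
- by rewrite mulr_ge0 ?invr_ge0 ?ler0n// addr_ge0// mulr_ge0.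
- move=> n; apply: le_trans (LY _ _) _; rewrite ler_wpM2l// exprS.
  by rewrite ler_piMl ?exprn_ge0// ltW.
move=> n; rewrite sqrt_iterS -scalerBr opprD addrACA subrr addr0.
rewrite normrZ ger0_norm ?invr_ge0 ?ler0n// -mulrA ler_wpM2l ?invr_ge0 ?ler0n//.
rewrite -[L (L x) - _](subrKA (Y B n (L x))) -bopB mulrDl.
apply: le_trans (ler_normD _ _) (lerD (LY _ _) _).
by apply: le_trans (sqrt_iter_bound _ _) _; rewrite -mulrA ler_wpM2l//; exact: LY.
Qed.

Lemma sqrt_limit_intertwine (W : completeNormedModType C) (B' : bop W W)
    (L' : bop W W) (T : bop V W) :
  (forall n x, `|L' x - Y B' n x| <= `|x| / (1 - b) * b ^+ n) ->
  (forall x, T (B x) = B' (T x)) -> forall x, T (L x) = L' (T x).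
Proof.
move=> LY' TB x; have [d d0 dT] := bop_bound T.
apply: (@geo_unique _ _ (fun n => T (Y B n x)) b
  (d * (`|x| / (1 - b))) (`|T x| / (1 - b)) _ _ b0 b1) => //.
- by rewrite mulr_ge0.
- by rewrite divr_ge0// subr_ge0 ltW.
- by move=> n; rewrite -bopB -mulrA; apply: le_trans (dT _) _; rewrite ler_wpM2l.
by move=> n; rewrite (sqrt_iter_intertwine TB).
Qed.
End Facts.
End Limit.
End SquareRoot.

Section PositiveRoot.
Variable R : realType.
Local Notation C := R[i].

Section Symmetric.
Variables (V : hilbertType R) (B : bop V V) (b : C).
Hypotheses (b0 : 0 <= b) (b1 : b < 1) (Bb : forall x, `|B x| <= b * `|x|).

Lemma sqrt_limit_sq (L : bop V V) : sqrt_limit B b L ->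
  forall y, y - L y - L (y - L y) = y - B y.
Proof.
move=> LY y; have e : L y *+ 2 = L (L y) + B y.
  by rewrite {1}(sqrt_limit_eq b0 b1 Bb LY) -scaler_nat scalerA mulfV ?scale1r.
have -> : B y = L y + L y - L (L y) by rewrite -mulr2n e addrC addKr.
by rewrite bopB -addrA -opprD -addrA.
Qed.

Hypothesis Bsym : forall x y, dot (B x) y = dot x (B y).

Lemma sqrt_iter_sym n x y : dot (sqrt_iter B n x) y = dot x (sqrt_iter B n y).
Proof.
elim: n x y => [|n IH] x y; first by rewrite /= dot0l dot0r.
rewrite !sqrt_iterS dotZl dotZr fmorphV/= conjC_nat.
by rewrite dotDl dotDr Bsym !IH.
Qed.

Lemma sqrt_limit_sym (L : bop V V) : sqrt_limit B b L ->
  forall x y, dot (L x) y = dot x (L y).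
Proof.
move=> LY x y.
have c0 (z : V) : 0 <= `|z| / (1 - b) :> C by rewrite divr_ge0// subr_ge0 ltW.
apply: (@geo_unique _ (C^o) (fun n => dot x (sqrt_iter B n y)) b
  (`|x| / (1 - b) * `|y|) (`|x| * (`|y| / (1 - b))) _ _ b0 b1).
- by rewrite mulr_ge0.
- by rewrite mulr_ge0.
- move=> n; rewrite -sqrt_iter_sym -dotBl; apply: le_trans (cauchy_schwarz _ _) _.
  by rewrite mulrAC ler_wpM2r//; exact: LY.
- move=> n; rewrite -dotBr; apply: le_trans (cauchy_schwarz _ _) _.
  by rewrite -mulrA ler_wpM2l//; exact: LY.
Qed.

(* psqrt is an arbitrary choice: uniqueness holds because any positive root S of 1 - B
   commutes with the limit L, so that S + (1 - L), which is bounded below, kills S - (1 - L). *)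
Lemma psqrt_limit (L : bop V V) : sqrt_limit B b L ->
  forall x, psqrt (fun x => x - B x) x = x - L x.
Proof.
move=> LY x; have Lsym := sqrt_limit_sym LY.
have Lb := sqrt_limit_bound b0 b1 Bb LY.
have Q2 y : y - L y - L (y - L y) = y - B y := sqrt_limit_sq LY y.
have Qpos y : (1 - b) * `|y| ^+ 2 <= dot y (y - L y).
  rewrite dotBr dot_norm mulrBl mul1r lerB//.
  have Lr : dot y (L y) \is Num.real.
    by apply/CrealP; rewrite -dot_conj Lsym.
  apply: le_trans (real_ler_norm Lr) _; apply: le_trans (cauchy_schwarz _ _) _.
  by rewrite mulrC expr2 mulrA ler_wpM2r//; exact: Lb.
set S := psqrt _.
have [bS Spos S2] : [/\ bounded_op S, forall x, 0 <= dot x (S x) &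
    forall x, S (S x) = x - B x].
  apply: (@xgetPex _ (fun=> 0) [set S : V -> V |
    [/\ bounded_op S, forall x, 0 <= dot x (S x) & forall x, S (S x) = x - B x]]).
  exists (bop_fun (bop_sub (bop_id V) L)); split=> [|y|y]; first exact: bopP.
    rewrite bop_subE; apply: le_trans (Qpos _).
    by rewrite mulr_ge0 ?exprn_ge0// subr_ge0 ltW.
  by rewrite !bop_subE; exact: Q2.
(* Since B = 1 - T^2, the root T commutes with B, hence with the limit L of polynomials in B. *)
pose T := Bop bS; have TL y : T (L y) = L (T y).
  apply: (sqrt_limit_intertwine b0 b1 LY LY) => z.
  have BE u : B u = u - T (T u) by rewrite /= S2 subKr.
  by rewrite !BE bopB.
pose w := T x - (x - L x).
have Tw : T w + (w - L w) = 0.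
  have -> : T w = (x - B x) - (T x - L (T x)) by rewrite /w 2!bopB TL [T (T x)]S2.
  have -> : w - L w = (T x - L (T x)) - (x - B x).
    rewrite -Q2 /w; set q := x - L x.
    by rewrite bopB subrACA.
  by rewrite subrKA subrr.
have w0 : w = 0.
  apply/eqP; rewrite -normr_eq0 -sqrf_eq0 eq_le exprn_ge0// andbT.
  rewrite -(ler_pM2l (_ : 0 < 1 - b)) ?subr_gt0// mulr0.
  apply: le_trans (Qpos _) _.
  have /(congr1 (dot w)) := Tw; rewrite dotDr dot0r => h.
  by rewrite -h lerDr; exact: Spos.
by apply/eqP; rewrite -subr_eq0; apply/eqP.
Qed.
End Symmetric.

Lemma psqrtP (V : hilbertType R) (B : bop V V) (b : C) :
  0 <= b -> b < 1 -> (forall x, `|B x| <= b * `|x|) ->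
  (forall x y, dot (B x) y = dot x (B y)) ->
  let D := psqrt (fun x => x - B x) in
  [/\ bounded_op D, forall x, D (D x) = x - B x & forall x y, dot (D x) y = dot x (D y)].
Proof.
move=> b0 b1 Bb Bsym D; have [L LY] := sqrt_limit_exists b0 b1 Bb.
have DL := psqrt_limit b0 b1 Bb Bsym LY.
have Ds x y : dot (D x) y = dot x (D y).
  by rewrite /D !DL dotBl dotBr (sqrt_limit_sym b0 b1 Bsym LY).
have DE : D = bop_sub (bop_id V) L by apply/funext => x; rewrite bop_subE /D DL.
split=> // [|x]; first by rewrite DE; exact: bopP.
by rewrite /D !DL (sqrt_limit_sq b0 b1 Bb LY).
Qed.

(** Both roots come from the same iteration, with the same rate b, so they inherit the relation
    between B and B'. *)
Lemma psqrt_intertwine (V W : hilbertType R) (B : bop V V) (B' : bop W W) (b : C)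
    (T : bop V W) : 0 <= b -> b < 1 ->
  (forall x, `|B x| <= b * `|x|) -> (forall x y, dot (B x) y = dot x (B y)) ->
  (forall x, `|B' x| <= b * `|x|) -> (forall x y, dot (B' x) y = dot x (B' y)) ->
  (forall x, T (B x) = B' (T x)) ->
  forall x, T (psqrt (fun x => x - B x) x) = psqrt (fun x => x - B' x) (T x).
Proof.
move=> b0 b1 Bb Bs Bb' Bs' TB x.
have [L LY] := sqrt_limit_exists b0 b1 Bb.
have [L' LY'] := sqrt_limit_exists b0 b1 Bb'.
rewrite (psqrt_limit b0 b1 Bb Bs LY) (psqrt_limit b0 b1 Bb' Bs' LY') bopB.
by rewrite (sqrt_limit_intertwine b0 b1 LY LY' TB).
Qed.
End PositiveRoot.

(** * Extending maps from total families *)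

Section Extension.
Variable R : realType.
Local Notation C := R[i].

(** The ratios of a log-convex sequence do not decrease. If r = a 1 / a 0 exceeded b, then a k >= r
    ^+ k * a 0 would outgrow K * b ^+ k. *)
Lemma log_convex (a : nat -> C) (b K : C) : 0 <= b -> 0 <= K ->
  (forall k, 0 <= a k) -> (forall k, a k.+1 ^+ 2 <= a k * a k.+2) ->
  (forall k, a k <= K * b ^+ k) -> a 1%N <= b * a 0%N.
Proof.
move=> b0 K0 a0 aa aK.
rewrite real_leNgt ?ger0_real ?mulr_ge0//; apply/negP => lt.
have a1 : 0 < a 1%N by apply: le_lt_trans lt; rewrite mulr_ge0.
have a00 : 0 < a 0%N.
  rewrite lt_def a0 andbT; apply/negP => /eqP e.
  by have := lt_le_trans (exprn_gt0 2 a1) (aa 0%N); rewrite e mul0r ltxx.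
pose r := a 1%N / a 0%N.
have r0 : 0 < r by rewrite divr_gt0.
have br : b < r by rewrite ltr_pdivlMr.
have ar k : 0 < a k /\ r * a k <= a k.+1.
  elim: k => [|k [ak IH]]; first by rewrite divfK ?gt_eqF.
  have ak1 : 0 < a k.+1 by apply: lt_le_trans IH; rewrite mulr_gt0.
  split=> //; rewrite -(ler_pM2l ak); apply: le_trans (aa k).
  by rewrite expr2 mulrCA mulrA ler_wpM2r.
have rk k : r ^+ k * a 0%N <= a k.
  elim: k => [|k IH]; first by rewrite mul1r.
  by rewrite exprS -mulrA; apply: le_trans (ar k).2; rewrite ler_wpM2l// ltW.
have c0 : 0 <= b / r by rewrite divr_ge0// ltW.
have c1 : b / r < 1 by rewrite ltr_pdivrMr// mul1r.
have [n /(_ _ (leqnn n))] := geo_small c0 c1 K0 a00.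
rewrite expr_div_n mulrA ltr_pdivrMr ?exprn_gt0// => /(le_lt_trans (aK n)).
by rewrite mulrC => /(le_lt_trans (rk n)); rewrite ltxx.
Qed.

(** The vectors u i may be linearly dependent, so sending u i to g i need not define a map. The span
    P of the pairs (u i, g i) is treated as a linear relation. The bound on P survives closure,
    which makes the closed relation G the graph of a bounded operator. *)
Lemma extend (V : normedModType C) (W : completeNormedModType C) I
    (u : I -> V) (g : I -> W) (c : C) : 0 <= c ->
  closure (lspan (range u)) = setT ->
  (forall q : V * W, lspan (range (fun i => (u i, g i) : V * W)) q ->
     `|q.2| <= c * `|q.1|) ->
  exists T : bop V W, (forall i, T (u i) = g i) /\ forall y, `|T y| <= c * `|y|.
Proof.
move=> c0 du; set P := lspan _ => Pc.
have Plin a p q : P p -> P q -> P (a *: p + q) by exact: lspan_linear.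
pose G y z := forall e : C, 0 < e -> exists2 q, P q & `|y - q.1| < e /\ `|z - q.2| < e.
have Gb y z : G y z -> `|z| <= c * `|y|.
  move=> Gyz; apply: (@le_eps _ _ _ (1 + c)) => //.
  - by rewrite ger0_real// mulr_ge0.
  - by rewrite addr_ge0.
  move=> e e0; have [q Pq [h1 h2]] := Gyz e e0.
  rewrite -[z](subrK q.2); apply: le_trans (ler_normD _ _) _.
  rewrite mulrDl mul1r addrCA lerD ?(ltW h2)//.
  apply: le_trans (Pc _ Pq) _; rewrite -mulrDr ler_wpM2l//.
  rewrite -[q.1](subrK y) addrC; apply: le_trans (ler_normD _ _) _.
  by rewrite lerD// distrC ltW.
have Glin a y z y' z' : G y z -> G y' z' -> G (a *: y + y') (a *: z + z').
  move=> h h' e e0.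
  have e2 : 0 < e / 2 by rewrite divr_gt0.
  have a1 : 0 < `|a| + 1 by rewrite ltr_wpDl.
  have [q Pq [h1 h2]] := h _ (divr_gt0 e2 a1).
  have [q' Pq' [h1' h2']] := h' _ e2.
  exists (a *: q + q'); first exact: Plin.
  have aux (X : normedModType C) (x x' t t' : X) :
      `|x - t| < e / 2 / (`|a| + 1) -> `|x' - t'| < e / 2 ->
      `|a *: x + x' - (a *: t + t')| < e.
    move=> k k'; rewrite opprD addrACA -scalerBr.
    apply: le_lt_trans (ler_normD _ _) _; rewrite normrZ [ltRHS](splitr e).
    apply: ler_ltD => //; move: k; rewrite ltr_pdivlMr// mulrC => /ltW; apply: le_trans.
    by rewrite ler_wpM2r// lerDl.
  by split; apply: aux.
have /choice[T GT] y : exists z, G y z.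
  pose q : C := 2^-1.
  have q0 : 0 < q by rewrite invr_gt0.
  have q1 : q < 1 by rewrite invf_lt1// ltr1n.
  (* First components converge to y at rate q ^+ n; the bound on P makes the second components
     Cauchy at the same rate, and their limit is the value at y. *)
  have /choice[p hp] n : exists p, P p /\ `|y - p.1| < q ^+ n.
    have /in_closure /(_ (q ^+ n)) [|a ua ya] : closure (lspan (range u)) y by rewrite du.
      by rewrite exprn_gt0.
    suff [z Pz] : exists z, P (a, z) by exists (a, z).
    apply: (@lspan_ind _ _ _ (fun a => exists z, P (a, z)) _ _ _ _ ua).
    - by exists 0; exact: lspan0.
    - by move=> k x x' [z Pz] [z' Pz']; exists (k *: z + z'); exact: (Plin k _ _ Pz Pz').
    - by move=> _ [i _ <-]; exists (g i); apply: lspan_gen; exists i.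
  have lip n : `|(p n.+1).2 - (p n).2| <= c * (1 + q) * q ^+ n.
    have Pd : P (p n.+1 - p n).
      rewrite addrC -scaleN1r; apply: Plin; first by case: (hp n).
      by case: (hp n.+1).
    apply: le_trans (Pc _ Pd) _; rewrite -mulrA ler_wpM2l//=.
    rewrite -[_ - _](subrKA y) addrC; apply: le_trans (ler_normD _ _) _.
    rewrite mulrDl mul1r -exprS lerD// ?(ltW (hp n).2)// distrC.
    exact: ltW (hp n.+1).2.
  have [z _ hz] := geo_cvg (ltW q0) q1 lip; exists z => e e0.
  set K := c * _ / _ in hz.
  have K0 : 0 <= K.
    by rewrite divr_ge0 ?subr_ge0 ?(ltW q1)// mulr_ge0// addr_ge0// ltW.
  have [n /(_ _ (leqnn _)) hn] := geo_small (ltW q0) q1 (addr_ge0 ler01 K0) e0.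
  rewrite mulrDl mul1r in hn.
  have [Pn yn] := hp n; exists (p n) => //; split.
    apply: lt_le_trans yn _; apply: le_trans (ltW hn).
    by rewrite lerDl mulr_ge0// exprn_ge0// ltW.
  apply: le_lt_trans (hz n) _; apply: le_lt_trans hn.
  by rewrite lerDr exprn_ge0// ltW.
have Gfun y z : G y z -> T y = z.
  move=> Gz; apply/eqP; rewrite -subr_eq0 -normr_eq0 eq_le normr_ge0 andbT.
  have := Gb _ _ (Glin (-1) _ _ _ _ Gz (GT y)).
  by rewrite !scaleN1r addNr normr0 mulr0 addrC.
have Tb y : `|T y| <= c * `|y| by exact: Gb.
suff bT : bounded_op T.
  exists (Bop bT); split=> //= i; apply: Gfun => e e0.
  exists (u i, g i); first by apply: lspan_gen; exists i.
  by rewrite /= !subrr !normr0.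
apply/bounded_opP; split=> [a x y|]; last by exists c.
exact/Gfun/Glin.
Qed.

Section Kernel.
Variables (V : hilbertType R) (I : Type) (u : I -> V) (c : C).
Hypotheses (c0 : 0 <= c) (du : closure (lspan (range u)) = setT).

(** By sesquilinearity the kernel identity holds on the whole span of pairs, so |q.2|^2 = <q.1, A
    q.1>, and Cauchy-Schwarz bounds it by c^2 |q.1|^2. *)
Lemma extend_kernel (W : hilbertType R) (g : I -> W) (A : bop V V) :
  (forall y, `|A y| <= c ^+ 2 * `|y|) ->
  (forall i j, dot (g i) (g j) = dot (u i) (A (u j))) ->
  exists T : bop V W, (forall i, T (u i) = g i) /\ forall y, `|T y| <= c * `|y|.
Proof.
move=> Ac gA; apply: extend => // q Pq.
have ker p p' : lspan (range (fun i => (u i, g i) : V * W)) p ->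
    lspan (range (fun i => (u i, g i) : V * W)) p' -> dot p.2 p'.2 = dot p.1 (A p'.1).
  move=> Pp; move: p'; apply: lspan_ind.
  - by rewrite bop0 !dot0r.
  - by move=> k v w /= hv hw; rewrite bop_linear !dot_linear hv hw.
  move=> _ [j _ <-] /=; move: p Pp; apply: lspan_ind.
  - by rewrite !dot0l.
  - by move=> k v w /= hv hw; rewrite !(dotDl, dotZl) hv hw.
  by move=> _ [i _ <-] /=.
rewrite -(@ler_pXn2r _ 2)// ?nnegrE ?mulr_ge0//.
rewrite -[X in X ^+ 2]normr_id -normrX -dot_norm ker//.
apply: le_trans (cauchy_schwarz _ _) _.
by rewrite exprMn [`|q.1| ^+ 2]expr2 mulrCA ler_wpM2l.
Qed.

Variable alpha : I -> I.
Hypothesis alpha_sym : forall i j, dot (u (alpha i)) (u j) = dot (u i) (u (alpha j)).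
Hypothesis alpha_bound : forall i, exists2 K : C, 0 <= K &
  forall k, `|u (iter k alpha i)| <= K * (c ^+ 2) ^+ k.

(* For s_k = \sum_i c_i u (alpha^k i), |s_(k+1)|^2 = <s_k, s_(k+2)>, so |s_k| is
   log-convex, and growth at most geometric of ratio c^2 forces |s_1| <= c^2 |s_0|.  This
   replaces the positivity of matrices over M in bounding phi(a) (x) I and I (x) T. *)
Lemma extend_symmetric : exists A : bop V V,
  (forall i, A (u i) = u (alpha i)) /\ forall y, `|A y| <= c ^+ 2 * `|y|.
Proof.
apply: extend => //; first exact: exprn_ge0.
move=> q Pq; pose f i : nat -> V := fun k => u (iter k alpha i).
have [s fs -> {q Pq}] : exists2 s, lspan (range f) s & q = (s 0%N, s 1%N).
  apply: (@lspan_ind _ _ _ (fun q => exists2 s, lspan (range f) s & q = (s 0%N, s 1%N))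
    _ _ _ _ Pq).
  - by exists 0 => //; exact: lspan0.
  - move=> k _ _ [s hs ->] [t ht ->]; exists (k *: s + t) => //.
    exact: lspan_linear.
  - by move=> _ [i _ <-]; exists (f i) => //; apply: lspan_gen; exists i.
have shift s' t k l : lspan (range f) s' -> lspan (range f) t ->
    dot (s' k.+1) (t l) = dot (s' k) (t l.+1).
  move=> hs; move: t; apply: lspan_ind.
  - by rewrite !dot0r.
  - by move=> a v w hv hw; rewrite !dot_linear hv hw.
  move=> _ [j _ <-]; move: s' hs; apply: lspan_ind.
  - by rewrite !dot0l.
  - by move=> a v w hv hw; rewrite !(dotDl, dotZl) hv hw.
  by move=> _ [i _ <-]; rewrite /f !iterS alpha_sym.
have [K K0 hK] : exists2 K : C, 0 <= K & forall k, `|s k| <= K * (c ^+ 2) ^+ k.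
  move: s fs; apply: lspan_ind.
  - by exists 0 => // k; rewrite normr0 mul0r.
  - move=> a v w [K K0 hK] [L L0 hL]; exists (`|a| * K + L) => [|k].
      by rewrite addr_ge0// mulr_ge0.
    apply: le_trans (ler_normD _ _) _; rewrite mulrDl lerD//.
    by rewrite normrZ -mulrA ler_wpM2l.
  by move=> _ [i _ <-]; exact: alpha_bound.
apply: (@log_convex (fun k => `|s k|) _ K) => //; first exact: exprn_ge0.
move=> k; rewrite -[X in X ^+ 2]normr_id -normrX -dot_norm shift//.
exact: cauchy_schwarz.
Qed.

Lemma extend_sym_kernel (W : hilbertType R) (g : I -> W) :
  (forall i j, dot (g i) (g j) = dot (u i) (u (alpha j))) ->
  exists T : bop V W, (forall i, T (u i) = g i) /\ forall y, `|T y| <= c * `|y|.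
Proof.
move=> gu; have [A [Au Ac]] := extend_symmetric.
by apply: (extend_kernel Ac) => i j; rewrite Au.
Qed.
End Kernel.
End Extension.

(** * Normal representations and induced representations *)

Section Algebra.
Variables (R : realType) (M : wstarAlgType R).
Local Notation C := R[i].
Implicit Types a b : M.

Lemma star_one : star (aone : M) = aone.
Proof. by rewrite -[LHS]amul1r -{2}[aone]starK -starM amul1r starK. Qed.

Section NormalFamily.
Variables (W : hilbertType R) (J : Type) (u : J -> W) (act : M -> J -> J).
Hypothesis du : closure (lspan (range u)) = setT.
Hypothesis u_normal : forall i j, exists p : predual (s := M),
  forall a, dot (u i) (u (act a j)) = pairing a p.
Hypothesis act_star : forall a i j,
  dot (u (act a i)) (u j) = dot (u i) (u (act (star a) j)).
Hypothesis actM : forall a b i, act (amul a b) i = act a (act b i).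

(** Take alpha = act m with m = a' a, whose norm is |a|^2 by the C*-identity. Normality of the
    coefficients bounds |u (act b i)| by a constant times |b|, which is the geometric growth
    required along the orbit of alpha. *)
Lemma act_extend a : exists T : bop W W,
  (forall i, T (u i) = u (act a i)) /\ forall y, `|T y| <= `|a| * `|y|.
Proof.
set m := amul (star a) a; have mE : `|m| = `|a| ^+ 2 by rewrite star_norm.
apply: (extend_sym_kernel (normr_ge0 a) du (alpha := act m)).
- by move=> i j; rewrite act_star /m starM starK.
- move=> i; have [p hp] := u_normal i i.
  have ub b : `|u (act b i)| <= `|b| * (`|p| + 1).
    rewrite -(@ler_pXn2r _ 2)// ?nnegrE ?mulr_ge0// ?addr_ge0//.
    rewrite -[X in X ^+ 2]normr_id -normrX -dot_norm act_star -actM hp.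
    apply: le_trans (pairing_bound _ _) _.
    by rewrite star_norm exprMn ler_wpM2l ?exprn_ge0// le_sqrD1.
  (* At k = 0 the vector is u i, which need not be of the form u (act b i); the summand |u i| covers
     this case. *)
  exists (`|u i| + (`|p| + 1)); first by rewrite !addr_ge0.
  case=> [|k]; first by rewrite mulr1 lerDl addr_ge0.
  have [b -> bm] : exists2 b, iter k.+1 (act m) i = act b i & `|b| <= `|m| ^+ k.+1.
    elim: k => [|k [b IH bm]]; first by exists m.
    exists (amul m b); first by rewrite actM -IH.
    by apply: le_trans (amul_norm _ _) _; rewrite exprS ler_wpM2l.
  apply: le_trans (ub b) _; rewrite mulrC -mE ler_pM// ?addr_ge0//.
  by rewrite lerDr.
by move=> i j; rewrite act_star -actM.
Qed.
End NormalFamily.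
End Algebra.

Section Rep.
Variables (R : realType) (M : wstarAlgType R) (H : hilbertType R).
Variables (sigma : M -> H -> H) (hs : normal_rep sigma).
Local Notation C := R[i].

Lemma rep_pair h k : exists p : predual (s := M),
  forall a, dot h (sigma a k) = pairing a p.
Proof.
apply: (rep_normal hs (f := fun T => dot h (T k))) => e e0.
exists 1%N, (fun=> h), (fun=> k) => T c lT c0 cT.
by rewrite big_ord1 subrr normr0 mulr_ge0// ltW.
Qed.

(** [rep_bounded] gives each operator some bound; control by the norm of a comes from [act_extend]
    for the family of all vectors of H. *)
Lemma rep_norm a h : `|sigma a h| <= `|a| * `|h|.
Proof.
have [|||T [Tu Tb]] := @act_extend R M H H id sigma _ rep_pair _ _ a.
- rewrite -subTset => x _; apply/subset_closure/lspan_gen; exists x => //.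
- by move=> b x y; rewrite (rep_star hs).
- by move=> b c x; rewrite (repM hs).
by rewrite -Tu.
Qed.

Lemma rep_one h : sigma aone h = h.
Proof.
have -> : sigma aone h = Bop (rep_bounded hs aone) h by [].
apply: (bop_eq (rep_nondegenerate hs) (T := bop_id H)) => _ [a [k ->]] /=.
by rewrite -(repM hs) amul1l.
Qed.
End Rep.

Section Tensor.
Variables (R : realType) (M : wstarAlgType R).
Local Notation C := R[i].

Lemma lact_pair (X : wcorrType M) (x y : X) (p : predual (s := M)) :
  exists p' : predual (s := M), forall a, pairing (inner x (lact a y)) p = pairing a p'.
Proof.
apply: (lact_normal (fun T => pairing (inner x (T y)) p)) => e e0.
exists 1%N, (fun=> p), (fun=> x), (fun=> y) => T c aT c0 cT.
by rewrite big_ord1 subrr normr0 mulr_ge0// ltW.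
Qed.

Section General.
Variables (X : hilbertModType M) (V : hilbertType R) (rho : M -> V -> V).
Variables (Y : htensor X rho).

Lemma ht_dense : closure (lspan (range (fun p : X * V => ht Y p.1 p.2))) = setT.
Proof.
rewrite -subTset -(ht_total Y) => v; apply: closure_subset => w.
by apply: lspan_sub => _ [x [h ->]]; apply: lspan_gen; exists (x, h).
Qed.

Lemma ht_ext (Z : normedModType C) (S T : bop Y Z) :
  (forall x h, S (ht Y x h) = T (ht Y x h)) -> S =1 T.
Proof. by move=> ST; apply: (bop_eq ht_dense) => _ [[x h] _ <-]; exact: ST. Qed.

(** Totality of the simple tensors leaves [ht_lift] no freedom once one bounded operator with the
    prescribed values is exhibited. *)
Lemma ht_liftP (Z : hilbertType R) (g : X -> V -> Z) (T : bop Y Z) :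
  (forall x h, T (ht Y x h) = g x h) -> ht_lift (Y := Y) g = T.
Proof.
move=> Tg; have [bS Sg] : bounded_op (ht_lift (Y := Y) g) /\
    forall x h, ht_lift (Y := Y) g (ht Y x h) = g x h.
  apply: (@xgetPex _ (fun=> 0) [set T : Y -> Z | bounded_op T /\
    forall x h, T (ht Y x h) = g x h]).
  by exists (bop_fun T); split=> //; exact: bopP.
apply/funext; apply: (ht_ext (S := Bop bS)) => x h /=.
by rewrite Sg Tg.
Qed.

Hypothesis rho_bounded : forall a, bounded_op (rho a).

Lemma ht_bound x : exists2 K : C, 0 <= K & forall h, `|ht Y x h| <= K * `|h|.
Proof.
have [d d0 hd] := bop_bound (Bop (rho_bounded (inner x x))).
exists (d + 1) => [|h]; first by rewrite addr_ge0.
rewrite -(@ler_pXn2r _ 2)// ?nnegrE ?mulr_ge0// ?addr_ge0//.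
rewrite -[X in X ^+ 2]normr_id -normrX -dot_norm ht_dot.
apply: le_trans (cauchy_schwarz _ _) _.
rewrite exprMn [`|h| ^+ 2]expr2 mulrCA ler_wpM2l//.
by apply: le_trans (hd _) _; rewrite ler_wpM2r// le_sqrD1.
Qed.

Lemma ht_bounded x : bounded_op (ht Y x).
Proof. by apply/bounded_opP; split=> [a h k|]; [exact: ht_linearr|exact: ht_bound]. Qed.

(** The Gram kernel of g is that of I (x) B. Iterating alpha applies powers of B to the second leg
    only, so its orbits grow like (c ^+ 2) ^+ k. Typically B = T' T for an operator I (x) T to be
    built. *)
Lemma tensor_op (Z : hilbertType R) (g : X -> V -> Z) (B : bop V V) (c : C) :
  0 <= c -> (forall h, `|B h| <= c ^+ 2 * `|h|) ->
  (forall h k, dot (B h) k = dot h (B k)) ->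
  (forall a h, B (rho a h) = rho a (B h)) ->
  (forall x x' h h', dot (g x h) (g x' h') = dot h (rho (inner x x') (B h'))) ->
  exists T : bop Y Z, (forall x h, T (ht Y x h) = g x h) /\
    forall y, `|T y| <= c * `|y|.
Proof.
move=> c0 Bc Bs Br gB.
have [||[x h] [x' h']|T [Tg Tc]] := extend_sym_kernel c0 ht_dense
  (alpha := fun p => (p.1, B p.2)) _ _ (g := fun p => g p.1 p.2).
- by move=> [x h] [x' h'] /=; rewrite !ht_dot Bs Br.
- move=> [x h].
  have [K K0 hK] := ht_bound x.
  exists (K * `|h|) => [|k]; first by rewrite mulr_ge0.
  have -> : iter k (fun p => (p.1, B p.2)) (x, h) = (x, iter k B h) :> X * V.
    by elim: k => //= k ->.
  have Bk : `|iter k B h| <= (c ^+ 2) ^+ k * `|h|.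
    elim: k => [|k IH]; first by rewrite mul1r.
    by rewrite iterS exprS -mulrA; apply: le_trans (Bc _) _; rewrite ler_wpM2l ?exprn_ge0.
  by apply: le_trans (hK _) _; rewrite -mulrA ler_wpM2l// mulrC.
- by rewrite /= gB ht_dot.
by exists T; split=> // x h; exact: (Tg (x, h)).
Qed.
End General.
End Tensor.

Section Orthogonality.
Variable R : realType.
Local Notation C := R[i].

Lemma dot_cspan (V : hilbertType R) (A : set V) v z : closure (lspan A) v ->
  (forall a, A a -> dot a z = 0) -> dot v z = 0.
Proof.
move=> cv Az; apply: (@cspan_ind _ _ A (fun v => dot v z = 0)) cv => //.
- exact: dot0l.
- by move=> c x y /= xz yz; rewrite dotDl dotZl xz yz mulr0 addr0.
move=> x /in_closure cx; apply/eqP; rewrite -normr_eq0 eq_le normr_ge0 andbT.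
apply: (@le_eps _ _ _ `|z|) => // e e0; have [a /= az xa] := cx e e0.
rewrite add0r -[dot x z]subr0 -az -dotBl mulrC.
by apply: le_trans (cauchy_schwarz _ _) _; rewrite ler_wpM2r// ltW.
Qed.

Lemma dot_dense (V : hilbertType R) (A : set V) z : closure (lspan A) = setT ->
  (forall a, A a -> dot a z = 0) -> z = 0.
Proof. by move=> dA Az; apply/dot_eq0/(dot_cspan _ Az); rewrite dA. Qed.

Lemma adj_bop_dense (V W : hilbertType R) (A : set V) (B : set W)
    (S : bop V W) (T : bop W V) :
  closure (lspan A) = setT -> closure (lspan B) = setT ->
  (forall a b, A a -> B b -> dot (S a) b = dot a (T b)) -> adj_bop S =1 T.
Proof.
move=> dA dB ST; apply: (bop_eq dB) => b Bb; apply/eqP; rewrite -subr_eq0; apply/eqP.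
by apply: (dot_dense dA) => a Aa; rewrite dotBr -adj_bopE ST// subrr.
Qed.
End Orthogonality.

(** * From weak-* totality to norm density *)

Section NormalTotal.
Variables (R : realType) (M : wstarAlgType R).
Local Notation C := R[i].

Lemma pairingZr (a : M) c (p : predual (s := M)) : pairing a (c *: p) = c * pairing a p.
Proof.
have p0 : pairing a (0 : predual (s := M)) = 0.
  by have := pairing_linearr (-1) a 0 0; rewrite scaler0 addr0 mulN1r addNr.
by rewrite -[c *: p]addr0 pairing_linearr p0 addr0.
Qed.

(* S is only weak-* total.  If w is the component of tau x j orthogonal to tau S J, then w
   is a norm limit of combinations of vectors tau x j, so z |-> <w, tau z k> is weak-*
   continuous; it vanishes on S, hence everywhere. *)
Lemma normal_total (X : hilbertModType M) (W : hilbertType R) (J : Type)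
    (tau : X -> J -> W) (S : set X) :
  (forall c x y j, tau (c *: x + y) j = c *: tau x j + tau y j) ->
  (forall j j', exists p : predual (s := M), forall x x',
     dot (tau x j) (tau x' j') = pairing (inner x x') p) ->
  wstar_total (M := M) S ->
  forall x j, closure (lspan [set v | exists s j', S s /\ v = tau s j']) (tau x j).
Proof.
move=> tl tn tS x j; set A := [set v | _].
have [p pA wA] := projection A (tau x j); set w := tau x j - p in wA.
suff : w = 0 by move=> /eqP; rewrite subr_eq0 => /eqP ->.
pose B := [set tau z.1 z.2 | z in [set: X * J]].
have AB : A `<=` lspan B by move=> _ [s [k [_ ->]]]; apply: lspan_gen; exists (s, k).
have wB : closure (lspan B) w.
  rewrite /w addrC -scaleN1r; apply: closure_linear.
  - by move=> *; exact: lspan_linear.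
  - by apply: cspan_sub pA => v /AB; exact: subset_closure.
  - by apply/subset_closure/lspan_gen; exists (x, j).
suff wt z k : dot w (tau z k) = 0.
  apply/dot_eq0/(dot_cspan wB) => _ [[z k] _ <-] /=.
  by rewrite dot_conj wt rmorph0.
pose f z := dot w (tau z k).
have fl c y y' : f (c *: y + y') = c * f y + f y' by rewrite /f tl dot_linear.
have fS y : lspan S y -> f y = 0.
  apply: (@lspan_ind _ _ _ (fun y => f y = 0)) => [|c u v fu fv|s Ss].
  - by have := fl (-1) 0 0; rewrite scaler0 addr0 mulN1r addNr.
  - by rewrite fl fu fv mulr0 addr0.
  - by rewrite /f dot_conj (wA (tau s k)) ?rmorph0//; exists s, k.
have fc : wstar_cont (M := M) f.
  move=> e e0; have [q hq] := tn k k.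
  have tb y : `|tau y k| <= (`|q| + 1) * `|y|.
    rewrite -(@ler_pXn2r _ 2)// ?nnegrE ?mulr_ge0// ?addr_ge0//.
    rewrite -[X in X ^+ 2]normr_id -normrX -dot_norm hq.
    apply: le_trans (pairing_bound _ _) _.
    by rewrite inner_norm exprMn mulrC ler_wpM2r ?exprn_ge0// le_sqrD1.
  have q1 : 0 < `|q| + 1 by rewrite ltr_wpDl.
  have [a [n [c [s [sB aE]]]] wa] := (in_closure _ _).1 wB _ (divr_gt0 e0 q1).
  have /choice[g gE] i : exists u, tau u.1 u.2 = s i by case: (sB i) => y _ <-; exists y.
  have /choice[r rE] i := tn (g i).2 k.
  exists n, (fun i => (c i)^* *: r i), (fun i => (g i).1) => y.
  have -> : \sum_i pairing (inner (g i).1 y) ((c i)^* *: r i) = dot a (tau y k).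
    rewrite aE (big_morph (fun v => dot v (tau y k)) (fun u v => dotDl u v _) (dot0l _)).
    by apply: eq_bigr => i _; rewrite pairingZr -rE gE dotZl.
  rewrite -dotBl; apply: le_trans (cauchy_schwarz _ _) _.
  apply: le_trans (ler_wpM2l (normr_ge0 _) (tb y)) _.
  by rewrite mulrA ler_wpM2r// -ler_pdivlMr// ltW.
apply/eqP; rewrite -normr_eq0 eq_le normr_ge0 andbT.
apply: (@le_eps _ _ _ 1) => // e e0; rewrite add0r mul1r.
have [v Sv hv] := tS z 1%N (fun=> f) e (fun=> fc) e0.
by have := hv ord0; rewrite (fS v Sv) subr0 => /ltW.
Qed.
End NormalTotal.

Section Induced.
Variables (R : realType) (M : wstarAlgType R) (H : hilbertType R).
Variables (sigma : M -> H -> H) (hs : normal_rep sigma).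
Local Notation C := R[i].

Section One.
Variables (X : wcorrType M) (Y : htensor X sigma).

Lemma ht_normal h h' : exists p : predual (s := M), forall x x',
  dot (ht Y x h) (ht Y x' h') = pairing (inner x x') p.
Proof.
by have [p hp] := rep_pair hs h h'; exists p => x x'; rewrite ht_dot.
Qed.

Lemma ind_rep_exists a : exists T : bop Y Y,
  (forall x h, T (ht Y x h) = ht Y (lact a x) h) /\ forall y, `|T y| <= `|a| * `|y|.
Proof.
have [||| T [Tu Tb]] := @act_extend R M Y (X * H) (fun p => ht Y p.1 p.2)
  (fun a p => (lact a p.1, p.2)) (ht_dense Y) _ _ _ a.
- move=> [x h] [x' h'] /=; have [p hp] := rep_pair hs h h'.
  have [p' hp'] := lact_pair x x' p.
  by exists p' => b; rewrite ht_dot hp hp'.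
- by move=> b [x h] [x' h'] /=; rewrite !ht_dot lact_adj.
- by move=> b c [x h] /=; rewrite lactM.
by exists T; split=> // x h; rewrite (Tu (x, h)).
Qed.

Lemma ind_repP a : [/\ bounded_op (ind_rep (Y := Y) a),
  forall x h, ind_rep a (ht Y x h) = ht Y (lact a x) h &
  forall y, `|ind_rep a y| <= `|a| * `|y :> Y| ].
Proof.
have [T [Tu Tb]] := ind_rep_exists a.
by have -> : ind_rep (Y := Y) a = T := ht_liftP Tu; split=> //; exact: bopP.
Qed.

Definition ind_bop a : bop Y Y := let: And3 b _ _ := ind_repP a in Bop b.

Lemma ind_bopE a y : ind_bop a y = ind_rep a y.
Proof. by rewrite /ind_bop; case: ind_repP. Qed.

Lemma ind_rep_bounded a : bounded_op (ind_rep (Y := Y) a).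
Proof. by case: (ind_repP a). Qed.

Lemma ind_bop_ht a x h : ind_bop a (ht Y x h) = ht Y (lact a x) h.
Proof. by rewrite ind_bopE; case: (ind_repP a). Qed.

Lemma ind_bop_norm a y : `|ind_bop a y| <= `|a| * `|y|.
Proof. by rewrite ind_bopE; case: (ind_repP a). Qed.

Lemma ind_bop0 y : ind_bop 0 y = 0.
Proof.
by apply/eqP; rewrite -normr_eq0 eq_le normr_ge0 andbT -(mul0r `|y|) -(@normr0 _ M) ind_bop_norm.
Qed.

Lemma ind_bop_adj a : adj_bop (ind_bop a) =1 ind_bop (star a).
Proof.
apply: (adj_bop_dense (ht_dense Y) (ht_dense Y)) => _ _ [[x h] _ <-] [[x' h'] _ <-] /=.
by rewrite !ind_bop_ht !ht_dot lact_adj.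
Qed.
End One.
End Induced.

(** * Tensor powers and the Fock space *)

Section FormDense.
Variable R : realType.
Local Notation C := R[i].

(** The identity says that T is the adjoint of S'^* S, and [adj_bop_dense] checks that on total
    sets. *)
Lemma form_dense (V W Z : hilbertType R) (A : set V) (B : set W)
    (S : bop V Z) (S' : bop W Z) (T : bop W V) :
  closure (lspan A) = setT -> closure (lspan B) = setT ->
  (forall a b, A a -> B b -> dot (S a) (S' b) = dot a (T b)) ->
  forall x y, dot (S x) (S' y) = dot x (T y).
Proof.
move=> dA dB ST x y.
have := @adj_bop_dense _ _ _ A B (bop_comp (adj_bop S') S) T dA dB _ y.
move=> <-; first by rewrite -adj_bopE /= -adj_bopEr.
by move=> a b Aa Bb /=; rewrite -adj_bopEr ST.
Qed.
End FormDense.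

Section Words.
Variables (R : realType) (M : wstarAlgType R) (E : wcorrType M).
Variables (P : tensor_powers E).
Local Notation C := R[i].

Lemma word_eq (e e' : nat -> E) i : (forall k, (k < i)%N -> e k = e' k) ->
  word P e i = word P e' i.
Proof.
elim: i => //= i IH ee; rewrite IH ?ee// => k ki; apply: ee; exact: ltnW.
Qed.

Lemma tensor_word_eq j (x : tp P j) (e e' : nat -> E) i :
  (forall k, (k < i)%N -> e k = e' k) -> tensor_word x e i = tensor_word x e' i.
Proof.
elim: i => //= i IH ee; rewrite IH ?ee// => k ki; apply: ee; exact: ltnW.
Qed.

(** Letters of a word are read from an infinite sequence, so a letter is appended by overwriting
    position i. *)
Definition snoc (e : nat -> E) i d k := if k == i then d else e k.

Lemma word_snoc e i d : word P (snoc e i d) i.+1 = tpS (word P e i) d.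
Proof.
rewrite /= {2}/snoc eqxx; congr (tpS _ _); apply: word_eq => k ki.
by rewrite /snoc ltn_eqF.
Qed.

Lemma tensor_word_snoc j (x : tp P j) e i d :
  tensor_word x (snoc e i d) i.+1 = tpS (tensor_word x e i) d.
Proof.
rewrite /= {2}/snoc eqxx; congr (tpS _ _); apply: tensor_word_eq => k ki.
by rewrite /snoc ltn_eqF.
Qed.

Lemma tp_unitE a : tp_unit P a = ract (tp_unit P aone) a.
Proof. by rewrite -tp_unit_ract amul1l. Qed.

(** Words nest to the left, with x innermost. After the last letters are stripped, the left action
    of <x, x> slides onto the prefix, where the induction hypothesis applies. This is the Gram
    kernel of left creation by x. *)
Lemma inner_tensor_word j (x : tp P j) e e' i :
  inner (tensor_word x e i) (tensor_word x e' i) =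
  inner (word P e i) (lact (inner x x) (word P e' i)) :> M.
Proof.
elim: i => [|i IH] /=.
  by rewrite -tp_unit_lact amul1r tp_unit_inner star_one amul1l.
have h := tpS_tensor P i; have h' := tpS_tensor P (i + j).
by rewrite (wt_inner h') -(wt_lact h) (wt_inner h) IH.
Qed.

(* The family is indexed by an arbitrary J so that the induction can move the last tensor
   factor from the correspondence into the index set. *)
Lemma words_dense i (W : hilbertType R) (J : Type) (act : M -> J -> J)
    (tau : tp P i -> J -> W) :
  (forall c x y j, tau (c *: x + y) j = c *: tau x j + tau y j) ->
  (forall j j', exists p : predual (s := M), forall x x',
     dot (tau x j) (tau x' j') = pairing (inner x x') p) ->
  (forall x a j, tau (ract x a) j = tau x (act a j)) ->
  forall x j, closure (lspan [set v | exists e j', v = tau (word P e i) j']) (tau x j).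
Proof.
elim: i J act tau => [|i IH] J act tau tl tn tb x j.
  have [g _ gK] := tp_unit_bij P; rewrite -(gK x) tp_unitE tb.
  by apply/subset_closure/lspan_gen; exists (fun=> 0), (act (g x) j).
have ht := tpS_tensor P i.
apply: (cspan_sub _ (@normal_total _ _ _ _ _ _ _ tl tn (wt_total ht) x j)).
move=> _ [_ [k [[y [e ->]] ->]]].
pose tau' y (p : E * J) := tau (tpS y p.1) p.2.
have := @IH (E * J)%type (fun a p => (lact a p.1, p.2)) tau'.
move=> /(_ _ _ _ y (e, k)) IHt; apply: (cspan_sub _ (IHt _ _ _)).
- move=> _ [e' [[d l] ->]]; apply/subset_closure/lspan_gen.
  by exists (snoc e' i d), l; rewrite word_snoc.
- by move=> c z z' [d l]; rewrite /tau' (wt_linearl ht) tl.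
- move=> [d l] [d' l'] /=; have [p hp] := tn l l'.
  have [p' hp'] := lact_pair d d' p.
  by exists p' => z z'; rewrite /tau' hp (wt_inner ht).
- by move=> z a [d l]; rewrite /tau' /= (wt_balanced ht).
Qed.
End Words.

Lemma cspan_total (R : realType) (V : normedModType R[i]) (A B : set V) :
  closure (lspan A) = setT -> A `<=` closure (lspan B) -> closure (lspan B) = setT.
Proof. by move=> dA AB; rewrite -subTset -dA => v; apply: cspan_sub. Qed.

Section Powers.
Variables (R : realType) (M : wstarAlgType R) (E : wcorrType M).
Variables (H : hilbertType R) (sigma : M -> H -> H) (hs : normal_rep sigma).
Variables (EH : htensor E sigma).
Variables (P : tensor_powers E) (TH : forall n, htensor (tp P n) sigma).
Variables (F : fock P) (FH : htensor F sigma) (FD : htensor F (ind_rep (Y := EH))).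
Local Notation C := R[i].
Local Notation rho := (ind_rep (Y := EH)).

Lemma word_total i :
  closure (lspan (range (fun p : (nat -> E) * H => ht (TH i) (word P p.1 i) p.2))) = setT.
Proof.
apply: (cspan_total (ht_dense (TH i))) => _ [[x h] _ <-] /=.
have := @words_dense _ _ _ P i _ H sigma (ht (TH i)).
move=> /(_ _ _ _ x h) wd; apply: (cspan_sub _ (wd _ _ _)).
- by move=> _ [e [k ->]]; apply/subset_closure/lspan_gen; exists (e, k).
- by move=> *; exact: ht_linearl.
- exact: (ht_normal hs (TH i)).
- by move=> *; exact: ht_balanced.
Qed.

Lemma tpS_total n :
  closure (lspan (range (fun p : (tp P n * E) * H => ht (TH n.+1) (tpS p.1.1 p.1.2) p.2)))
  = setT.
Proof.
apply: (cspan_total (ht_dense (TH n.+1))) => _ [[x h] _ <-] /=.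
have := @normal_total _ _ _ _ _ (ht (TH n.+1)) _ _ (ht_normal hs (TH n.+1))
  (wt_total (tpS_tensor P n)).
move=> /(_ _ x h) wd; apply: (cspan_sub _ (wd _)).
- by move=> _ [_ [k [[y [e ->]] ->]]]; apply/subset_closure/lspan_gen; exists (y, e, k).
- by move=> *; exact: ht_linearl.
Qed.

Lemma fockH_total : closure (lspan (range (fun p : {n & (tp P n * H)%type} =>
  ht FH (fock_in F (projT2 p).1) (projT2 p).2))) = setT.
Proof.
apply: (cspan_total (ht_dense FH)) => _ [[x h] _ <-] /=.
have := @normal_total _ _ _ _ _ (ht FH) _ _ (ht_normal hs FH) (@fock_total _ _ _ _ F).
move=> /(_ _ x h) wd; apply: (cspan_sub _ (wd _)).
- move=> _ [_ [k [[n [y ->]] ->]]]; apply/subset_closure/lspan_gen.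
  by exists (existT _ n (y, k)).
- by move=> *; exact: ht_linearl.
Qed.

(** Normality of the coefficients is checked at d = e (x) h, where it follows from sigma and the
    left action of E. A general d is then reached through the bounded map d |-> x (x) d. *)
Lemma fockD_total : closure (lspan (range (fun p : {n & (tp P n * EH)%type} =>
  ht FD (fock_in F (projT2 p).1) (projT2 p).2))) = setT.
Proof.
set B := range _.
apply: (cspan_total (ht_dense FD)) => _ [[x d] _ <-] /=.
pose T := Bop (ht_bounded FD (ind_rep_bounded hs EH) x).
have dE : closure (lspan (range (fun p : E * H => ht EH p.1 p.2))) d by rewrite ht_dense.
apply: (@cspan_ind _ _ _ (fun d => closure (lspan B) (T d)) _ _ _ _ _ dE).
- by rewrite bop0; exact/subset_closure/lspan0.
- by move=> c u v hu hv; rewrite bop_linear; apply: closure_linear => // *; exact: lspan_linear.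
- move=> _ [[e h] _ <-] /=.
  have := @normal_total _ _ F FD (E * H)%type (fun z p => ht FD z (ht EH p.1 p.2)) _ _ _
    (@fock_total _ _ _ _ F).
  move=> /(_ _ _ x (e, h)) wd; apply: (cspan_sub _ (wd _ _)).
  + move=> _ [_ [[e' k] [[n [y ->]] ->]]]; apply/subset_closure/lspan_gen.
    by exists (existT _ n (y, ht EH e' k)).
  + by move=> *; exact: ht_linearl.
  + move=> [e' k] [e'' k'] /=; have [p hp] := rep_pair hs k k'.
    have [p' hp'] := lact_pair e' e'' p.
    exists p' => z z'; rewrite ht_dot -hp' -hp -ind_bopE ind_bop_ht.
    by rewrite ht_dot.
by move=> v cv; apply: closure_closure; apply: closure_bop cv.
Qed.

Section Assoc.
Variables (n : nat) (x : tp P n).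

(** The Gram kernel of d |-> x (x) d is the induced action of <x, x>, of norm at most |x|^2. The
    same kernel gives [ltensor_exists] and [fock_ltensor_exists]. *)
Lemma tensor_assoc_exists : exists T : bop EH (TH n.+1),
  forall e h, T (ht EH e h) = ht (TH n.+1) (tpS x e) h.
Proof.
have [|[e h] [e' h']|T [Tu _]] := @extend_kernel _ _ _ _ _ (normr_ge0 x) (ht_dense EH)
  (TH n.+1) (fun p => ht (TH n.+1) (tpS x p.1) p.2) (ind_bop hs EH (inner x x)).
- by move=> y; rewrite -inner_norm; exact: ind_bop_norm.
- by rewrite /= ind_bop_ht !ht_dot (wt_inner (tpS_tensor P n)).
by exists T => e h; rewrite (Tu (e, h)).
Qed.

Lemma tensor_assoc_bounded : bounded_op (tensor_assoc (EH := EH) TH x).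
Proof. by have [T /ht_liftP TE] := tensor_assoc_exists; rewrite /tensor_assoc TE; exact: bopP. Qed.

Definition assoc_bop := Bop tensor_assoc_bounded.

Lemma assoc_bop_ht e h : assoc_bop (ht EH e h) = ht (TH n.+1) (tpS x e) h.
Proof. by have [T Tu] := tensor_assoc_exists; rewrite /= /tensor_assoc (ht_liftP Tu). Qed.
End Assoc.

Lemma dot_assoc n (x x' : tp P n) d d' :
  dot (assoc_bop x d) (assoc_bop x' d') = dot d (rho (inner x x') d').
Proof.
rewrite -(ind_bopE hs); apply: (form_dense (ht_dense EH) (ht_dense EH)).
move=> _ _ [[e h] _ <-] [[e' h'] _ <-].
by rewrite !assoc_bop_ht ind_bop_ht !ht_dot (wt_inner (tpS_tensor P n)).
Qed.

Section Ltensor.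
Variables (j : nat) (x : tp P j) (i : nat).

Lemma ltensor_exists : exists T : bop (TH i) (TH (i + j)), forall e h,
  T (ht (TH i) (word P e i) h) = ht (TH (i + j)) (tensor_word x e i) h.
Proof.
have [|[e h] [e' h']|T [Tu _]] := @extend_kernel _ _ _ _ _ (normr_ge0 x) (word_total i)
  (TH (i + j)) (fun p => ht (TH (i + j)) (tensor_word x p.1 i) p.2)
  (ind_bop hs (TH i) (inner x x)).
- by move=> y; rewrite -inner_norm; exact: ind_bop_norm.
- by rewrite /= ind_bop_ht !ht_dot inner_tensor_word.
by exists T => e h; rewrite (Tu (e, h)).
Qed.

Lemma ltensorP : bounded_op (ltensor (TH := TH) x (i := i)) /\
  forall e h, ltensor (TH := TH) x (ht (TH i) (word P e i) h) =
    ht (TH (i + j)) (tensor_word x e i) h.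
Proof.
apply: (@xgetPex _ (fun=> 0) [set T : TH i -> TH (i + j) | bounded_op T /\
  forall e h, T (ht (TH i) (word P e i) h) = ht (TH (i + j)) (tensor_word x e i) h]).
by have [T Tu] := ltensor_exists; exists (bop_fun T); split=> //; exact: bopP.
Qed.

Definition ltensor_bop := Bop ltensorP.1.

Lemma ltensor_bop_word e h :
  ltensor_bop (ht (TH i) (word P e i) h) = ht (TH (i + j)) (tensor_word x e i) h.
Proof. exact: ltensorP.2. Qed.

End Ltensor.

Lemma dot_ltensor j (x : tp P j) i y y' :
  dot (ltensor_bop x i y) (ltensor_bop x i y') = dot y (ind_bop hs (TH i) (inner x x) y').
Proof.
apply: (form_dense (word_total i) (word_total i)).
move=> _ _ [[e h] _ <-] [[e' h'] _ <-].
by rewrite !ltensor_bop_word ind_bop_ht !ht_dot inner_tensor_word.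
Qed.

Lemma ltensor_bop_assoc j (x : tp P j) i e d :
  ltensor_bop x i.+1 (assoc_bop (word P e i) d) = assoc_bop (tensor_word x e i) d.
Proof.
apply: (ht_ext (S := bop_comp (ltensor_bop x i.+1) (assoc_bop (word P e i)))) => e' h.
change (ltensor_bop x i.+1 (assoc_bop (word P e i) (ht EH e' h)) =
  assoc_bop (tensor_word x e i) (ht EH e' h)).
by rewrite !assoc_bop_ht -word_snoc ltensor_bop_word tensor_word_snoc.
Qed.

Section Summand.
Variable n : nat.

Lemma summand_exists : exists T : bop (TH n) FH,
  forall x h, T (ht (TH n) x h) = ht FH (fock_in F x) h.
Proof.
have [|||x x' h h'|T [Tu _]] := @tensor_op _ _ _ _ _ (TH n) (rep_bounded hs) FH
  (fun x h => ht FH (fock_in F x) h) (bop_id H) 1 ler01.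
- by move=> h; rewrite expr1n mul1r.
- by [].
- by [].
- by rewrite ht_dot fock_in_inner.
by exists T.
Qed.

Lemma summand_bounded : bounded_op (summand FH (TH := TH) (n := n)).
Proof. by have [T /ht_liftP TE] := summand_exists; rewrite /summand TE; exact: bopP. Qed.

Definition summand_bop := Bop summand_bounded.

Lemma summand_bop_ht x h : summand_bop (ht (TH n) x h) = ht FH (fock_in F x) h.
Proof. by have [T Tu] := summand_exists; rewrite /= /summand (ht_liftP Tu). Qed.

Lemma dot_summand_bop y y' : dot (summand_bop y) (summand_bop y') = dot y y'.
Proof.
apply: (form_dense (T := bop_id (TH n)) (ht_dense (TH n)) (ht_dense (TH n))).
by move=> _ _ [[x h] _ <-] [[x' h'] _ <-]; rewrite !summand_bop_ht !ht_dot fock_in_inner.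
Qed.

End Summand.

Lemma rep0 h : sigma 0 h = 0.
Proof.
apply/eqP; rewrite -normr_eq0 eq_le normr_ge0 andbT.
by rewrite -(mul0r `|h|) -(@normr0 _ M) rep_norm.
Qed.

Lemma summand_bop_orth m n (y : TH m) (y' : TH n) : m != n ->
  dot (summand_bop m y) (summand_bop n y') = 0.
Proof.
move=> mn; rewrite -[RHS](dot0r y).
apply: (form_dense (T := bop_zero (TH n) (TH m)) (ht_dense (TH m)) (ht_dense (TH n))).
move=> _ _ [[x h] _ <-] [[x' h'] _ <-]; rewrite !summand_bop_ht ht_dot fock_in_orth//.
by rewrite rep0 !dot0r.
Qed.

Lemma summand_total :
  closure (lspan (range (fun p : {n & TH n} => summand_bop _ (projT2 p)))) = setT.
Proof.
apply: (cspan_total fockH_total) => _ [[n [x h]] _ <-] /=.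
apply/subset_closure/lspan_gen; exists (existT _ n (ht (TH n) x h)) => //=.
exact: summand_bop_ht.
Qed.

Lemma ind_summand_bop a n y :
  ind_bop hs FH a (summand_bop n y) = summand_bop n (ind_bop hs (TH n) a y).
Proof.
apply: (ht_ext (S := bop_comp (ind_bop hs FH a) (summand_bop n))
  (T := bop_comp (summand_bop n) (ind_bop hs (TH n) a))) => x h.
change (ind_bop hs FH a (summand_bop n (ht (TH n) x h)) =
  summand_bop n (ind_bop hs (TH n) a (ht (TH n) x h))).
by rewrite ind_bop_ht !summand_bop_ht ind_bop_ht fock_in_lact.
Qed.

Section FockLtensor.
Variables (j : nat) (x : tp P j).

Lemma fock_ltensor_exists : exists T : bop FH FH, forall i y,
  T (summand_bop i y) = summand_bop (i + j) (ltensor_bop x i y).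
Proof.
have [|[i y] [i' y']|T [Tu _]] := @extend_kernel _ _ _ _ _ (normr_ge0 x) summand_total
  FH (fun p => summand_bop (projT1 p + j) (ltensor_bop x _ (projT2 p))) (ind_bop hs FH (inner x x)).
- by move=> y; rewrite -inner_norm; exact: ind_bop_norm.
- rewrite [projT1 _]/= [projT2 _]/= [projT1 _]/= [projT2 _]/= ind_summand_bop.
  have [e|ii] := eqVneq i i'; first by subst i'; rewrite !dot_summand_bop dot_ltensor.
  by rewrite !summand_bop_orth// eqn_add2r.
by exists T => i y; rewrite (Tu (existT _ i y)).
Qed.

Lemma fock_ltensorP : bounded_op (fock_ltensor TH (FH := FH) x) /\ forall i y,
  fock_ltensor TH x (summand_bop i y) = summand_bop (i + j) (ltensor_bop x i y).
Proof.
apply: (@xgetPex _ (fun=> 0) [set T : FH -> FH | bounded_op T /\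
    forall i (y : TH i), T (summand FH y) = summand FH (ltensor x y)]).
by have [T Tu] := fock_ltensor_exists; exists (bop_fun T); split=> //; exact: bopP.
Qed.

Definition fock_ltensor_bop := Bop fock_ltensorP.1.

Lemma fock_ltensor_bop_summand i y :
  fock_ltensor_bop (summand_bop i y) = summand_bop (i + j) (ltensor_bop x i y).
Proof. exact: fock_ltensorP.2. Qed.
End FockLtensor.
End Powers.

(** * Poisson kernel and characteristic operator *)

Section TensorSymmetric.
Variables (R : realType) (M : wstarAlgType R) (X : hilbertModType M).
Variables (V : hilbertType R) (rho : M -> V -> V) (Y : htensor X rho).
Hypothesis rho_bounded : forall a, bounded_op (rho a).
Variable S : bop V V.
Hypothesis Ssym : forall h k, dot (S h) k = dot h (S k).
Hypothesis Srho : forall a h, S (rho a h) = rho a (S h).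

Lemma id_tensorP : bounded_op (ht_lift (Y := Y) (fun x h => ht Y x (S h))) /\
  forall x h, ht_lift (Y := Y) (fun x h => ht Y x (S h)) (ht Y x h) = ht Y x (S h).
Proof.
have [c c0 cS] := bop_bound S.
have [||||T [Tu _]] := @tensor_op _ _ _ _ _ Y rho_bounded Y (fun x h => ht Y x (S h))
  (bop_comp S S) c c0.
- by move=> h /=; apply: le_trans (cS _) _; rewrite expr2 -mulrA ler_wpM2l.
- by move=> h k /=; rewrite !Ssym.
- by move=> a h /=; rewrite !Srho.
- by move=> x x' h h'; rewrite ht_dot Ssym /= !Srho.
by rewrite (ht_liftP Tu); split=> //; exact: bopP.
Qed.

Definition id_tensor_bop := Bop id_tensorP.1.

Lemma id_tensor_bop_ht x h : id_tensor_bop (ht Y x h) = ht Y x (S h).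
Proof. exact: id_tensorP.2. Qed.

Lemma id_tensor_bop_sym y z : dot (id_tensor_bop y) z = dot y (id_tensor_bop z).
Proof.
apply: (form_dense (S' := bop_id Y) (ht_dense Y) (ht_dense Y)).
move=> _ _ [[x h] _ <-] [[x' h'] _ <-].
by rewrite !id_tensor_bop_ht !ht_dot Ssym Srho.
Qed.
End TensorSymmetric.

(** * Neumann series of a strict contraction *)

Section Neumann.
Variables (R : realType) (V : hilbertType R) (N : bop V V) (c : R[i]).
Hypotheses (c0 : 0 <= c) (c1 : c < 1) (Nc : forall y, `|N y| <= c * `|y|).
Local Notation C := R[i].

Lemma norm_iter k y : `|iter k N y| <= `|y| * c ^+ k.
Proof.
elim: k => [|k IH]; first by rewrite mulr1.
by rewrite iterS; apply: le_trans (Nc _) _; rewrite exprS mulrCA ler_wpM2l.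
Qed.

Definition neumann_limit (G : V -> V) := forall y n,
  `|G y - series (fun k => iter k N y) n| <= `|y| / (1 - c) * c ^+ n.

Let K0 (y : V) : 0 <= `|y| / (1 - c) :> C.
Proof. by rewrite divr_ge0// subr_ge0 ltW. Qed.

Lemma neumann_exists : exists G : bop V V, neumann_limit G.
Proof.
have /choice[G hG] y : exists l, forall n,
    `|l - series (fun k => iter k N y) n| <= `|y| / (1 - c) * c ^+ n.
  have [n|l _ hl] := @geo_cvg _ V (series (fun k => iter k N y)) c `|y| c0 c1.
    by rewrite seriesSr addrC addKr norm_iter.
  by exists l.
suff bG : bounded_op G by exists (Bop bG) => y n; exact: hG.
have il k a u v : iter k N (a *: u + v) = a *: iter k N u + iter k N v.
  by elim: k => //= k ->; rewrite bop_linear.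
apply/bounded_opP; split=> [a u v|].
  apply: (@geo_unique _ _ (series (fun k => iter k N (a *: u + v))) c
    (`|a *: u + v| / (1 - c)) (`|a| * (`|u| / (1 - c)) + `|v| / (1 - c)) _ _ c0 c1
    (K0 _) _ (hG _)).
    exact: (addr_ge0 (mulr_ge0 (normr_ge0 a) (K0 u)) (K0 v)).
  move=> n; rewrite /series /= (eq_bigr _ (fun k _ => il k a u v)) big_split -scaler_sumr /=.
  rewrite opprD addrACA -scalerBr mulrDl.
  apply: le_trans (ler_normD _ _) _; apply: lerD; last exact: hG.
  by rewrite normrZ -mulrA ler_wpM2l//; exact: hG.
exists (1 - c)^-1 => [|x]; first by rewrite invr_ge0 subr_ge0 ltW.
by have := hG x 0%N; rewrite /series /= big_geq// subr0 expr0 mulr1 mulrC.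
Qed.

Variables (G : bop V V) (GN : neumann_limit G).

Lemma neumannl y : G y - N (G y) = y.
Proof.
apply/eqP; rewrite subr_eq; apply/eqP.
(* The common sequence is the partial sum of index n.+1, which equals y plus N applied to the
   partial sum of index n. *)
apply: (@geo_unique _ _ (fun n => series (fun k => iter k N y) n.+1) c
  (`|y| / (1 - c)) (c * (`|y| / (1 - c))) _ _ c0 c1) => //.
- by rewrite mulr_ge0.
- move=> n; apply: le_trans (GN _ _) _; rewrite ler_wpM2l// exprS.
  by rewrite ler_piMl ?exprn_ge0// ltW.
move=> n; have -> : series (fun k => iter k N y) n.+1 =
    y + N (series (fun k => iter k N y) n).
  rewrite /series /= big_nat_recl//= bop_sum; congr (_ + _); exact: eq_bigr.
rewrite opprD addrACA subrr add0r -bopB; apply: le_trans (Nc _) _.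
by rewrite -mulrA ler_wpM2l//; exact: GN.
Qed.

Lemma neumann_comm (T : bop V V) : (forall y, T (N y) = N (T y)) ->
  forall y, T (G y) = G (T y).
Proof.
move=> TN y; have [d d0 dT] := bop_bound T.
have Ti k : T (iter k N y) = iter k N (T y) by elim: k => //= k <-.
apply: (@geo_unique _ _ (fun n => T (series (fun k => iter k N y) n)) c
  (d * (`|y| / (1 - c))) (`|T y| / (1 - c)) _ _ c0 c1) => //.
- by rewrite mulr_ge0.
- move=> n; rewrite -bopB; apply: le_trans (dT _) _.
  by rewrite -mulrA ler_wpM2l//; exact: GN.
move=> n; rewrite /series /= bop_sum (eq_bigr _ (fun k _ => Ti k)).
exact: GN.
Qed.

Lemma neumannr y : G (y - N y) = y.
Proof. by rewrite bopB -(neumann_comm (T := N))// neumannl. Qed.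

(** Evaluates the [limn] in [poisson] and [theta], whose terms are a fixed bounded operator applied
    to the iterates of N. *)
Lemma neumann_lim (W : normedModType C) (T : bop V W) (f : nat -> W) y :
  (forall k, f k = T (iter k N y)) -> limn (series f) = T (G y).
Proof.
move=> fT; have [d d0 dT] := bop_bound T.
apply: cvg_lim; first exact: norm_hausdorff.
apply: (@geo_cvgP _ _ _ c (d * (`|y| / (1 - c)))) => //; first exact: mulr_ge0.
move=> n; rewrite /series /= (eq_bigr _ (fun k _ => fT k)) -bop_sum -bopB.
by apply: le_trans (dT _) _; rewrite -mulrA ler_wpM2l//; exact: GN.
Qed.
End Neumann.

(** * Operators on the Fock space and the final identity *)

Section Characteristic.
Variables (R : realType) (M : wstarAlgType R) (E : wcorrType M).
Variables (H : hilbertType R) (sigma : M -> H -> H) (hs : normal_rep sigma).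
Variables (EH : htensor E sigma).
Variables (P : tensor_powers E) (TH : forall n, htensor (tp P n) sigma).
Variables (F : fock P) (FH : htensor F sigma) (FD : htensor F (ind_rep (Y := EH))).
Local Notation C := R[i].
Local Notation rho := (ind_rep (Y := EH)).
Variables (eta : bop H EH) (c : C).
Hypotheses (c0 : 0 <= c) (c1 : c < 1) (eta_c : forall h, `|eta h| <= c * `|h|).
Hypothesis eta_rep : forall a h, eta (sigma a h) = rho a (eta h).

Lemma rho_star a d d' : dot (rho a d) d' = dot d (rho (star a) d').
Proof. by rewrite -!(ind_bopE hs) adj_bopE ind_bop_adj. Qed.

Lemma adj_eta_rep a d : adj_bop eta (rho a d) = sigma a (adj_bop eta d).
Proof.
apply: dot_inj => h; rewrite -adj_bopE -[X in dot _ (rho X _)]starK -rho_star -eta_rep adj_bopE.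
by rewrite (rep_star hs) starK.
Qed.

Lemma adj_eta_norm d : `|adj_bop eta d| <= c * `|d|.
Proof. exact: (adj_bound c0 (adj_bopE eta) eta_c). Qed.

Let B1 : bop H H := bop_comp (adj_bop eta) eta.
Let B2 : bop EH EH := bop_comp eta (adj_bop eta).

Let c20 : 0 <= c ^+ 2. Proof. exact: exprn_ge0. Qed.
Let c21 : c ^+ 2 < 1. Proof. by rewrite expr_lt1. Qed.

Let B1c h : `|B1 h| <= c ^+ 2 * `|h|.
Proof. by apply: le_trans (adj_eta_norm _) _; rewrite expr2 -mulrA ler_wpM2l. Qed.

Let B2c d : `|B2 d| <= c ^+ 2 * `|d|.
Proof. by apply: le_trans (eta_c _) _; rewrite expr2 -mulrA ler_wpM2l// adj_eta_norm. Qed.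

Let B1s h k : dot (B1 h) k = dot h (B1 k).
Proof. by rewrite /= -adj_bopEr -adj_bopE. Qed.

Let B2s h k : dot (B2 h) k = dot h (B2 k).
Proof. exact: etrans (adj_bopE eta _ _) (esym (adj_bopEr eta _ _)). Qed.

Let B1_rep a h : B1 (sigma a h) = sigma a (B1 h).
Proof. exact: etrans (congr1 (adj_bop eta) (eta_rep a h)) (adj_eta_rep a (eta h)). Qed.

Let B2_rep a d : B2 (rho a d) = rho a (B2 d).
Proof. exact: etrans (congr1 eta (adj_eta_rep a d)) (eta_rep a (adj_bop eta d)). Qed.

Lemma defect_star_bounded : bounded_op (defect_star eta).
Proof. by case: (psqrtP c20 c21 B1c B1s). Qed.

Lemma defect_bounded : bounded_op (defect eta).
Proof. by case: (psqrtP c20 c21 B2c B2s). Qed.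

Definition defect_star_bop := Bop defect_star_bounded.
Definition defect_bop := Bop defect_bounded.

Lemma defect_star_sq h : defect_star_bop (defect_star_bop h) = h - adj_bop eta (eta h).
Proof. by case: (psqrtP c20 c21 B1c B1s) => _ /(_ h). Qed.

Lemma defect_sq d : defect_bop (defect_bop d) = d - eta (adj_bop eta d).
Proof. by case: (psqrtP c20 c21 B2c B2s) => _ /(_ d). Qed.

Lemma defect_star_sym h k : dot (defect_star_bop h) k = dot h (defect_star_bop k).
Proof. by case: (psqrtP c20 c21 B1c B1s) => _ _ /(_ h k). Qed.

Lemma defect_sym h k : dot (defect_bop h) k = dot h (defect_bop k).
Proof. by case: (psqrtP c20 c21 B2c B2s) => _ _ /(_ h k). Qed.

(** The relation eta (eta' eta) = (eta eta') eta passes to square roots. *)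
Lemma eta_defect_star h : eta (defect_star_bop h) = defect_bop (eta h).
Proof. exact: (psqrt_intertwine (T := eta) c20 c21 B1c B1s B2c B2s). Qed.

Lemma defect_star_rep a h : defect_star_bop (sigma a h) = sigma a (defect_star_bop h).
Proof.
apply/esym; apply: (psqrt_intertwine (T := Bop (rep_bounded hs a)) c20 c21 B1c B1s B1c B1s).
by move=> k; rewrite B1_rep.
Qed.

Lemma defect_rep a d : defect_bop (rho a d) = rho a (defect_bop d).
Proof.
apply/esym; apply: (psqrt_intertwine (T := Bop (ind_rep_bounded hs EH a))
  c20 c21 B2c B2s B2c B2s).
by move=> k; rewrite B2_rep.
Qed.

Definition tp_defect_star n :=
  id_tensor_bop (TH n) (rep_bounded hs) defect_star_sym defect_star_rep.
Definition fock_defect_star :=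
  id_tensor_bop FH (rep_bounded hs) defect_star_sym defect_star_rep.
Definition fock_defect := id_tensor_bop FD (ind_rep_bounded hs EH) defect_sym defect_rep.

Lemma fock_defect_star_summand n y :
  fock_defect_star (summand_bop hs TH FH n y) = summand_bop hs TH FH n (tp_defect_star n y).
Proof.
apply: (ht_ext (S := bop_comp fock_defect_star (summand_bop hs TH FH n))
  (T := bop_comp (summand_bop hs TH FH n) (tp_defect_star n))) => x h.
change (fock_defect_star (summand_bop hs TH FH n (ht (TH n) x h)) =
  summand_bop hs TH FH n (tp_defect_star n (ht (TH n) x h))).
by rewrite /fock_defect_star /tp_defect_star id_tensor_bop_ht !summand_bop_ht id_tensor_bop_ht.
Qed.

Section EtaT.
Variable n : nat.

Lemma id_tensor_eta_exists : exists T : bop (TH n) (TH n.+1),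
  forall x h, T (ht (TH n) x h) = assoc_bop hs EH TH x (eta h).
Proof.
have [||T [Tu _]] := @tensor_op _ _ _ _ _ (TH n) (rep_bounded hs) (TH n.+1)
  (fun x h => assoc_bop hs EH TH x (eta h)) B1 c c0 B1c B1s.
- exact: B1_rep.
- by move=> x x' h h'; rewrite dot_assoc adj_bopE adj_eta_rep.
by exists T.
Qed.

Lemma id_tensor_eta_bounded : bounded_op (id_tensor_eta (TH := TH) eta (n := n)).
Proof.
by have [T /ht_liftP TE] := id_tensor_eta_exists; rewrite /id_tensor_eta [ht_lift _]TE; exact: bopP.
Qed.

Definition tp_eta := Bop id_tensor_eta_bounded.

Lemma tp_eta_ht x h : tp_eta (ht (TH n) x h) = assoc_bop hs EH TH x (eta h).
Proof.
by have [T Tu] := id_tensor_eta_exists; rewrite /= /id_tensor_eta [ht_lift _](ht_liftP Tu).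
Qed.
End EtaT.

Lemma fock_eta_exists : exists T : bop FH FD,
  (forall x h, T (ht FH x h) = ht FD x (eta h)) /\ forall y, `|T y| <= c * `|y|.
Proof.
apply: (@tensor_op _ _ _ _ _ FH (rep_bounded hs) FD
  (fun x h => ht FD x (eta h)) B1 c c0 B1c B1s).
- exact: B1_rep.
- by move=> x x' h h'; rewrite ht_dot adj_bopE adj_eta_rep.
Qed.

(** I (x) eta before [FD] is identified with a part of [FH], so that its second defect operator
    lives on [FD], the domain of Theta. *)
Definition fock_eta : bop FH FD := projT1 (cid fock_eta_exists).

Lemma fock_eta_ht x h : fock_eta (ht FH x h) = ht FD x (eta h).
Proof. exact: (projT2 (cid fock_eta_exists)).1. Qed.

Lemma fock_eta_norm y : `|fock_eta y| <= c * `|y|.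
Proof. exact: (projT2 (cid fock_eta_exists)).2. Qed.

Lemma adj_fock_eta_ht x d : adj_bop fock_eta (ht FD x d) = ht FH x (adj_bop eta d).
Proof.
apply/eqP; rewrite -subr_eq0; apply/eqP/(dot_dense (ht_dense FH)) => _ [[z h] _ <-].
by rewrite dotBr -adj_bopE fock_eta_ht !ht_dot adj_bopE adj_eta_rep subrr.
Qed.

Lemma fock_defect_star_sq y :
  fock_defect_star (fock_defect_star y) = y - adj_bop fock_eta (fock_eta y).
Proof.
rewrite -[RHS](bop_subE (bop_id FH) (bop_comp (adj_bop fock_eta) fock_eta)).
apply: (ht_ext (S := bop_comp fock_defect_star fock_defect_star)) => x h; rewrite bop_subE.
change (fock_defect_star (fock_defect_star (ht FH x h)) =
  ht FH x h - adj_bop fock_eta (fock_eta (ht FH x h))).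
rewrite fock_eta_ht adj_fock_eta_ht /fock_defect_star !id_tensor_bop_ht defect_star_sq.
exact: (bopB (Bop (ht_bounded FH (rep_bounded hs) x))).
Qed.

Lemma fock_defect_sq y : fock_defect (fock_defect y) = y - fock_eta (adj_bop fock_eta y).
Proof.
rewrite -[RHS](bop_subE (bop_id FD) (bop_comp fock_eta (adj_bop fock_eta))).
apply: (ht_ext (S := bop_comp fock_defect fock_defect)) => x h; rewrite bop_subE.
change (fock_defect (fock_defect (ht FD x h)) =
  ht FD x h - fock_eta (adj_bop fock_eta (ht FD x h))).
rewrite adj_fock_eta_ht fock_eta_ht /fock_defect !id_tensor_bop_ht defect_sq.
exact: (bopB (Bop (ht_bounded FD (ind_rep_bounded hs EH) x))).
Qed.

Lemma fock_eta_defect y : fock_eta (fock_defect_star y) = fock_defect (fock_eta y).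
Proof.
apply: (ht_ext (S := bop_comp fock_eta fock_defect_star)
  (T := bop_comp fock_defect fock_eta)) => x h.
change (fock_eta (fock_defect_star (ht FH x h)) = fock_defect (fock_eta (ht FH x h))).
rewrite /fock_defect_star /fock_defect id_tensor_bop_ht !fock_eta_ht.
by rewrite id_tensor_bop_ht eta_defect_star.
Qed.

(** Rebracketing x (x) d preserves inner products within a degree, and different degrees are
    orthogonal on both sides; the Gram kernel is therefore the identity of [FD]. *)
Lemma shift_exists : exists T : bop FD FH,
  (forall n (x : tp P n) d, T (ht FD (fock_in F x) d) =
     summand_bop hs TH FH n.+1 (assoc_bop hs EH TH x d)) /\ forall y, `|T y| <= 1 * `|y|.
Proof.
have [|[n [x d]] [n' [x' d']]|T [Tu Tc]] := @extend_kernel _ _ _ _ 1 ler01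
  (fockD_total hs FD) FH
  (fun p => summand_bop hs TH FH (projT1 p).+1 (assoc_bop hs EH TH (projT2 p).1 (projT2 p).2))
  (bop_id FD).
- by move=> y; rewrite expr1n mul1r.
- rewrite /projT1 /projT2 /fst /snd.
  change (bop_id FD (ht FD (fock_in F x') d')) with (ht FD (fock_in F x') d').
  have [e|nn] := eqVneq n n'.
    by subst n'; rewrite dot_summand_bop dot_assoc ht_dot fock_in_inner.
  by rewrite summand_bop_orth// ht_dot fock_in_orth// -(ind_bopE hs) ind_bop0 dot0r.
by exists T; split=> // n x d; rewrite (Tu (existT _ n (x, d))).
Qed.

Definition fock_shift : bop FD FH := projT1 (cid shift_exists).

Lemma fock_shift_ht n (x : tp P n) d :
  fock_shift (ht FD (fock_in F x) d) = summand_bop hs TH FH n.+1 (assoc_bop hs EH TH x d).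
Proof. exact: (projT2 (cid shift_exists)).1. Qed.

Lemma fock_shift_norm y : `|fock_shift y| <= `|y|.
Proof. by rewrite -[leRHS]mul1r; exact: (projT2 (cid shift_exists)).2. Qed.

Lemma fock_shiftK y : adj_bop fock_shift (fock_shift y) = y.
Proof.
apply: dot_inj => z; rewrite -adj_bopE.
apply: (form_dense (T := bop_id FD) (fockD_total hs FD) (fockD_total hs FD)).
move=> _ _ [[n [x d]] _ <-] [[n' [x' d']] _ <-]; rewrite /projT1 /projT2 /fst /snd.
change (bop_id FD (ht FD (fock_in F x') d')) with (ht FD (fock_in F x') d').
rewrite !fock_shift_ht; have [e|nn] := eqVneq n n'.
  by subst n'; rewrite dot_summand_bop dot_assoc ht_dot fock_in_inner.
by rewrite summand_bop_orth// ht_dot fock_in_orth// -(ind_bopE hs) ind_bop0 dot0r.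
Qed.

Definition vacuum : bop H FH := bop_comp (summand_bop hs TH FH 0)
  (Bop (ht_bounded (TH 0) (rep_bounded hs) (tp_unit P aone))).

Lemma vacuumE h :
  vacuum h = summand_bop hs TH FH 0 (ht (TH 0) (tp_unit P aone) h).
Proof. by []. Qed.

Lemma vacuumK h : adj_bop vacuum (vacuum h) = h.
Proof.
apply: dot_inj => k; rewrite -adj_bopE !vacuumE dot_summand_bop ht_dot tp_unit_inner.
by rewrite amul1r star_one (rep_one hs).
Qed.

Lemma dot_fock_shift_vacuum y h : dot (fock_shift y) (vacuum h) = 0.
Proof.
rewrite adj_bopE dot_conj.
rewrite (dot_dense (z := adj_bop fock_shift (vacuum h)) (fockD_total hs FD)) ?dot0l ?rmorph0//.
by move=> _ [[n [x d]] _ <-]; rewrite -adj_bopE fock_shift_ht vacuumE summand_bop_orth.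
Qed.

Lemma adj_fock_shift_vacuum h : adj_bop fock_shift (vacuum h) = 0.
Proof. by apply: dot_inj => y; rewrite -adj_bopE dot_fock_shift_vacuum dot0r. Qed.

Lemma adj_vacuum_fock_shift y : adj_bop vacuum (fock_shift y) = 0.
Proof. by apply: dot_inj => h; rewrite -adj_bopE dot_conj dot_fock_shift_vacuum rmorph0 dot0r. Qed.

(** The remainder w is killed by both adjoints, hence orthogonal to both ranges, which together
    contain a total set. *)
Lemma fock_decomp y : fock_shift (adj_bop fock_shift y) + vacuum (adj_bop vacuum y) = y.
Proof.
apply/esym/eqP; rewrite -subr_eq0; set w := y - _; apply/eqP.
have Uw : adj_bop fock_shift w = 0.
  by rewrite /w bopB bopD fock_shiftK adj_fock_shift_vacuum addr0 subrr.
have iw : adj_bop vacuum w = 0.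
  by rewrite /w bopB bopD vacuumK adj_vacuum_fock_shift add0r subrr.
apply: (dot_dense (fockH_total hs FH)) => _ [[n [x h]] _ <-]; rewrite /projT1 /projT2 /fst /snd.
rewrite -(summand_bop_ht hs TH FH) adj_bopE; case: n x => [|n] x.
  (* In degree zero x = 1 a, and a moves across the tensor sign onto h, so x (x) h is a value of
     [vacuum]. *)
  have [g _ gK] := tp_unit_bij P; rewrite -(gK x) tp_unitE ht_balanced -adj_bopE -vacuumE.
  by rewrite adj_bopE iw dot0r.
rewrite (dot_dense (z := adj_bop (summand_bop hs TH FH n.+1) w) (tpS_total hs TH n)) ?dot0r//.
move=> _ [[[x' e] k] _ <-]; rewrite -adj_bopE /fst /snd -(assoc_bop_ht hs EH TH) -fock_shift_ht.
by rewrite adj_bopE Uw dot0r.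
Qed.

Definition fock_step : bop FH FH := bop_comp fock_shift fock_eta.

Lemma fock_stepE y : fock_step y = fock_shift (fock_eta y). Proof. by []. Qed.

Lemma fock_step_norm y : `|fock_step y| <= c * `|y|.
Proof. exact: le_trans (fock_shift_norm _) (fock_eta_norm y). Qed.

Lemma fock_step_summand n y :
  fock_step (summand_bop hs TH FH n y) = summand_bop hs TH FH n.+1 (tp_eta n y).
Proof.
apply: (ht_ext (S := bop_comp fock_step (summand_bop hs TH FH n))
  (T := bop_comp (summand_bop hs TH FH n.+1) (tp_eta n))) => x h.
change (fock_step (summand_bop hs TH FH n (ht (TH n) x h)) =
  summand_bop hs TH FH n.+1 (tp_eta n (ht (TH n) x h))).
by rewrite fock_stepE summand_bop_ht fock_eta_ht fock_shift_ht tp_eta_ht.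
Qed.

Definition fock_resolvent : bop FH FH := projT1 (cid (neumann_exists c0 c1 fock_step_norm)).

Lemma fock_resolvent_limit : neumann_limit fock_step c fock_resolvent.
Proof. exact: (projT2 (cid (neumann_exists c0 c1 fock_step_norm))). Qed.

Lemma eta_pow_iter k h :
  summand_bop hs TH FH k (eta_pow TH eta k h) = iter k fock_step (vacuum h).
Proof. by elim: k => [//|k IH]; rewrite iterS -IH fock_step_summand. Qed.

Lemma poissonE h : poisson TH FH eta h = fock_defect_star (fock_resolvent (vacuum h)).
Proof.
apply: (neumann_lim c0 c1 fock_resolvent_limit) => k.
by rewrite -eta_pow_iter fock_defect_star_summand.
Qed.

Section Creation.
Variables (j : nat) (x : tp P j).
Local Notation L := (fock_ltensor_bop hs TH FH x).

Lemma ltensor_tp_eta i y : ltensor_bop hs TH x i.+1 (tp_eta i y) =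
  tp_eta (i + j) (ltensor_bop hs TH x i y).
Proof.
apply: (bop_eq (S := bop_comp (ltensor_bop hs TH x i.+1) (tp_eta i))
  (T := bop_comp (tp_eta (i + j)) (ltensor_bop hs TH x i)) (word_total hs TH i)).
move=> _ [[e h] _ <-]; rewrite /fst /snd.
change (ltensor_bop hs TH x i.+1 (tp_eta i (ht (TH i) (word P e i) h)) =
  tp_eta (i + j) (ltensor_bop hs TH x i (ht (TH i) (word P e i) h))).
by rewrite ltensor_bop_word !tp_eta_ht ltensor_bop_assoc.
Qed.

Lemma ltensor_defect_star i y :
  ltensor_bop hs TH x i (tp_defect_star i y) =
  tp_defect_star (i + j) (ltensor_bop hs TH x i y).
Proof.
apply: (bop_eq (S := bop_comp (ltensor_bop hs TH x i) (tp_defect_star i))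
  (T := bop_comp (tp_defect_star (i + j)) (ltensor_bop hs TH x i)) (word_total hs TH i)).
move=> _ [[e h] _ <-]; rewrite /fst /snd.
change (ltensor_bop hs TH x i (tp_defect_star i (ht (TH i) (word P e i) h)) =
  tp_defect_star (i + j) (ltensor_bop hs TH x i (ht (TH i) (word P e i) h))).
by rewrite /tp_defect_star id_tensor_bop_ht !ltensor_bop_word id_tensor_bop_ht.
Qed.

(** Creation by x works at the left end of a tensor and N at the right end. Commutation lets x pass
    through the resolvent in [char_bop_ht]. *)
Lemma fock_ltensor_step y : L (fock_step y) = fock_step (L y).
Proof.
apply: (bop_eq (S := bop_comp L fock_step) (T := bop_comp fock_step L) (summand_total hs TH FH)).
move=> _ [[i z] _ <-]; rewrite /projT2 /projT1.
change (L (fock_step (summand_bop hs TH FH i z)) = fock_step (L (summand_bop hs TH FH i z))).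
by rewrite fock_step_summand !fock_ltensor_bop_summand fock_step_summand ltensor_tp_eta.
Qed.

Lemma fock_ltensor_defect_star y : L (fock_defect_star y) = fock_defect_star (L y).
Proof.
apply: (bop_eq (S := bop_comp L fock_defect_star) (T := bop_comp fock_defect_star L)
  (summand_total hs TH FH)).
move=> _ [[i z] _ <-]; rewrite /projT2 /projT1.
change (L (fock_defect_star (summand_bop hs TH FH i z)) =
  fock_defect_star (L (summand_bop hs TH FH i z))).
rewrite fock_defect_star_summand !fock_ltensor_bop_summand.
by rewrite fock_defect_star_summand ltensor_defect_star.
Qed.

Lemma fock_ltensor_vacuum h : L (vacuum h) = ht FH (fock_in F x) h.
Proof.
rewrite vacuumE fock_ltensor_bop_summand.
have /= -> := ltensor_bop_word hs TH x 0 (fun=> 0) h.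
exact: summand_bop_ht.
Qed.
End Creation.

(** Built by iterating I (x) eta, so boundedness is immediate. The types fit because m.+1 + 1
    reduces to (m + 1).+1. *)
Fixpoint id1_eta_pow m : bop EH (TH (m + 1)%N) :=
  if m is k.+1 then bop_comp (tp_eta (k + 1)) (id1_eta_pow k)
  else assoc_bop hs EH TH (tp_unit P aone).

Lemma id1_eta_pow_ht m e h : id1_eta_pow m (ht EH e h) =
  ltensor_bop hs TH (tpS (tp_unit P aone) e) m (eta_pow TH eta m h).
Proof.
elim: m => [|m IH].
  rewrite [LHS]assoc_bop_ht.
  by have /= <- := ltensor_bop_word hs TH (tpS (tp_unit P aone) e) 0 (fun=> 0) h.
change (tp_eta (m + 1) (id1_eta_pow m (ht EH e h)) =
  ltensor_bop hs TH (tpS (tp_unit P aone) e) m.+1 (tp_eta m (eta_pow TH eta m h))).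
by rewrite IH ltensor_tp_eta.
Qed.

Definition fock_one : bop EH FH :=
  bop_comp (summand_bop hs TH FH 1) (assoc_bop hs EH TH (tp_unit P aone)).

Lemma id1_eta_pow_iter m d :
  summand_bop hs TH FH (m + 1) (id1_eta_pow m d) = iter m fock_step (fock_one d).
Proof. by elim: m => [//|m IH]; rewrite iterS -IH fock_step_summand. Qed.

Lemma thetaE d : theta TH FH eta d =
  fock_defect_star (fock_resolvent (fock_one (defect_bop d))) - vacuum (adj_bop eta d).
Proof.
rewrite /theta addrC; congr (_ + _); last by rewrite -bopN.
apply: (neumann_lim c0 c1 fock_resolvent_limit) => k.
rewrite -id1_eta_pow_iter fock_defect_star_summand.
by rewrite /id1_tensor_eta_pow (ht_liftP (id1_eta_pow_ht k)).
Qed.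

Lemma fock_ltensor_fock_one j (x : tp P j) d :
  fock_ltensor_bop hs TH FH x (fock_one d) = fock_shift (ht FD (fock_in F x) d).
Proof.
rewrite fock_shift_ht [LHS]fock_ltensor_bop_summand.
by have /= -> := ltensor_bop_assoc hs TH x 0 (fun=> 0) d.
Qed.

Definition char_bop : bop FD FH :=
  bop_sub (bop_comp fock_defect_star (bop_comp fock_resolvent
    (bop_comp fock_shift fock_defect))) (adj_bop fock_eta).

Lemma char_bopE y : char_bop y =
  fock_defect_star (fock_resolvent (fock_shift (fock_defect y))) - adj_bop fock_eta y.
Proof. by rewrite /char_bop bop_subE. Qed.

Lemma char_bop_ht j (x : tp P j) d :
  char_bop (ht FD (fock_in F x) d) = fock_ltensor TH x (theta TH FH eta d).
Proof.
rewrite char_bopE adj_fock_eta_ht /fock_defect id_tensor_bop_ht thetaE.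
change (fock_ltensor TH (FH := FH) x) with (bop_fun (fock_ltensor_bop hs TH FH x)).
rewrite bopB fock_ltensor_defect_star fock_ltensor_vacuum.
rewrite (neumann_comm c0 c1 fock_resolvent_limit (fock_ltensor_step x)).
by rewrite fock_ltensor_fock_one.
Qed.

Lemma char_opE : char_op TH FH (FD := FD) eta = char_bop.
Proof.
have [bT Tu] : bounded_op (char_op TH FH (FD := FD) eta) /\ forall j (x : tp P j) d,
    char_op TH FH eta (ht FD (fock_in F x) d) = fock_ltensor TH x (theta TH FH eta d).
  apply: (@xgetPex _ (fun=> 0) [set T : FD -> FH | bounded_op T /\
    forall j (x : tp P j) (d : EH),
      T (ht FD (fock_in F x) d) = fock_ltensor TH x (theta TH FH eta d)]).
  by exists (bop_fun char_bop); split; [exact: bopP|exact: char_bop_ht].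
apply/funext; apply: (bop_eq (S := Bop bT) (fockD_total hs FD)).
by move=> _ [[j [x d]] _ <-]; rewrite /projT2 /fst /snd char_bop_ht; exact: Tu.
Qed.

Lemma adj_fock_resolvent y :
  adj_bop fock_resolvent y - adj_bop fock_step (adj_bop fock_resolvent y) = y.
Proof.
apply: dot_inj => z; rewrite dotBr -adj_bopE -adj_bopE -adj_bopE -dotBl.
by rewrite -bopB (neumannr c0 c1 fock_step_norm fock_resolvent_limit).
Qed.

Lemma poisson_char y : let K := poisson TH FH eta in let T := char_op TH FH (FD := FD) eta in
  y = K (adj K y) + T (adj T y).
Proof.
have -> : poisson TH FH eta = bop_comp fock_defect_star (bop_comp fock_resolvent vacuum).
  by apply/funext => h; rewrite poissonE.
rewrite char_opE.
set K := bop_comp fock_defect_star _.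
change (y = K (adj_bop K y) + char_bop (adj_bop char_bop y)).
have KE h : K h = fock_defect_star (fock_resolvent (vacuum h)) by [].
(* z solves (I - N') z = D_* y. With u = S' z and v = N' z, the adjoints become K' y = V' z and
   Theta' y = D u - (I (x) eta) y. *)
set z := adj_bop fock_resolvent (fock_defect_star y).
have zE : fock_defect_star y = z - adj_bop fock_step z by rewrite /z adj_fock_resolvent.
have dsym_star (p q : FH) : dot (fock_defect_star p) q = dot p (fock_defect_star q)
  by exact: id_tensor_bop_sym.
have dsym (p q : FD) : dot (fock_defect p) q = dot p (fock_defect q) by exact: id_tensor_bop_sym.
set u := adj_bop fock_shift z; set v := adj_bop fock_eta u.
have vE : adj_bop fock_step z = v.
  by apply: dot_inj => p; rewrite -adj_bopE fock_stepE !adj_bopE.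
have -> : adj_bop K y = adj_bop vacuum z.
  by apply: dot_inj => h; rewrite -adj_bopE KE dsym_star 2!adj_bopE.
have -> : adj_bop char_bop y = fock_defect u - fock_eta y.
  apply: dot_inj => p; rewrite -adj_bopE char_bopE dotBl dotBr.
  by rewrite dsym_star 2!adj_bopE dsym -adj_bopEr.
have vD : adj_bop fock_eta (fock_defect u) = fock_defect_star v.
  by apply: dot_inj => p; rewrite -adj_bopE -dsym -fock_eta_defect adj_bopE dsym_star.
rewrite KE.
rewrite char_bopE addrA -!bopD.
(* Here S D^2 u = S S' z - N v, and S D (I (x) eta) y = N D_* y = N (z - v). The terms N v cancel,
   and V V' z + S S' z = z, so the resolvent acts on (I - N) z. *)
have -> : vacuum (adj_bop vacuum z) + fock_shift (fock_defect (fock_defect u - fock_eta y)) =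
    z - fock_step z.
  rewrite [fock_defect (_ - _)]bopB fock_defect_sq -fock_eta_defect zE vE -/v -addrA -opprD -bopD.
  by rewrite [v + _]addrC subrK bopB addrA [vacuum _ + _]addrC fock_decomp.
rewrite (neumannr c0 c1 fock_step_norm fock_resolvent_limit).
(* What remains is D_* (z - v) + N' N y, where D_* (z - v) = D_*^2 y = y - N' N y. *)
rewrite [adj_bop fock_eta _]bopB vD opprB addrCA.
by rewrite -bopB -vE -zE fock_defect_star_sq addrC subrK.
Qed.
End Characteristic.

Theorem theorem17 (R : realType) (M : wstarAlgType R) (E : wcorrType M)
    (H : hilbertType R) (sigma : M -> H -> H) (hsigma : normal_rep sigma)
    (EH : htensor E sigma)
    (P : tensor_powers E) (TH : forall n, htensor (tp P n) sigma)
    (F : fock P) (FH : htensor F sigma) (FD : htensor F (ind_rep (Y := EH)))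
    (eta : H -> EH) (heta : in_open_ball eta) :
  let K : H -> FH := poisson TH FH eta in
  let Theta : FD -> FH := char_op TH FH eta in
  forall y : FH, y = K (adj K y) + Theta (adj Theta y).
Proof.
move=> K T y; have [[be hrep] [c c1 hc]] := heta.
have [c0|c0] := boolP (0 <= c).
  exact: (poisson_char hsigma TH FD (eta := Bop be) c0 c1 hc hrep).
(* From c < 1 the scalar c is real, hence negative here; the bound then forces eta = 0, and the
   constant 0 serves. *)
apply: (poisson_char hsigma TH FD (eta := Bop be) (lexx 0) ltr01 _ hrep) => h /=.
rewrite mul0r; apply: le_trans (hc h) _; rewrite mulr_le0_ge0//.
by rewrite ltW// real_ltNge// ler1_real// ltW.
Qed.
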